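(* Let $I=[0,1]$ and let $\phi\colon F*\mathbb{Z}\to \mathrm{Diff}_+^1(I)$ be a homomorphism. Suppose that for every injective homomorphism $\iota\colon F\hookrightarrow F*\mathbb{Z}$ and for every connected component $J$ of $\operatorname{supp}\phi\iota(F)$, the action of $F$ on $J$ given by $g\mapsto \phi(\iota(g))|_J$ is either non-faithful or semi-conjugate to the standard piecewise linear action of $F$ on $[0,1]$. Then $\phi$ is not injective.
   Context: Thompson's group $F$ is the group of piecewise linear homeomorphisms of $[0,1]$ whose breakpoints are dyadic rationals and all of whose slopes are powers of $2$; its standard action is this action on $[0,1]$. For a group $G$ acting on $I$, $\operatorname{supp} g=I\setminus \mathrm{Fix}(g)$ and $\operatorname{supp} G=\bigcup_{g\in G}\operatorname{supp} g$. A semi-conjugacy between two actions on intervals is a monotone, surjective, continuous map between the (closed) intervals which intertwines the two actions. *)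

(* Defs.v *)
From Stdlib Require Import Reals List ZArith Relations.
Open Scope R_scope.
Import ListNotations.

Definition inI (x : R) : Prop := 0 <= x <= 1.

Definition dyadic (x : R) : Prop :=
  exists (m : Z) (k : nat), x = IZR m / 2 ^ k.

Definition continuous_on_I (f : R -> R) : Prop :=
  forall x, inI x -> forall eps, 0 < eps -> exists delta, 0 < delta /\
    forall y, inI y -> Rabs (y - x) < delta -> Rabs (f y - f x) < eps.

Definition homeo_I (f : R -> R) : Prop :=
  (forall x, inI x -> inI (f x)) /\ continuous_on_I f /\
  exists g : R -> R, (forall x, inI x -> inI (g x)) /\ continuous_on_I g /\
    (forall x, inI x -> g (f x) = x) /\ (forall x, inI x -> f (g x) = x).

(* Piecewise linear on [0,1], with dyadic breakpoints (a dyadic subdivision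
   0 = p 0 < p 1 < ... < p n = 1 on whose pieces f is affine) and all slopes
   integral powers of 2. Elements are normalised to be the identity outside
   [0,1], so that equality of elements of F is equality of functions. *)
Definition isF (f : R -> R) : Prop :=
  homeo_I f /\
  (forall x, ~ inI x -> f x = x) /\
  exists (n : nat) (p : nat -> R) (s : nat -> Z),
    p 0%nat = 0 /\ p n = 1 /\
    (forall i, (i < n)%nat -> p i < p (S i)) /\
    (forall i, (i <= n)%nat -> dyadic (p i)) /\
    (forall i, (i < n)%nat -> forall x, p i <= x <= p (S i) ->
        f x = f (p i) + powerRZ 2 (s i) * (x - p i)).

Definition Fel := { f : R -> R | isF f }.
Definition Fval (g : Fel) : R -> R := proj1_sig g.

Definition word := list (Fel + Z).

(* Elementary relations of the free product (group law of F is composition: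
   the word [inl a; inl b] stands for a o b). *)
Inductive wstep : word -> word -> Prop :=
| ws_F (a b c : Fel) :
    (forall x, Fval c x = Fval a (Fval b x)) -> wstep [inl a; inl b] [inl c]
| ws_F1 (e : Fel) : (forall x, Fval e x = x) -> wstep [inl e] []
| ws_Z (m n : Z) : wstep [inr m; inr n] [inr (m + n)%Z]
| ws_Z0 : wstep [inr 0%Z] [].

Inductive wrewrite : word -> word -> Prop :=
| wr_ctx (u l r v : word) : wstep l r -> wrewrite (u ++ l ++ v) (u ++ r ++ v).

Definition wequiv : word -> word -> Prop := clos_refl_sym_trans word wrewrite.

Definition derive_within_I (f : R -> R) (x l : R) : Prop :=
  forall eps, 0 < eps -> exists delta, 0 < delta /\
    forall y, inI y -> y <> x -> Rabs (y - x) < delta ->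
      Rabs ((f y - f x) / (y - x) - l) < eps.

Definition C1_on_I (f : R -> R) : Prop :=
  exists f' : R -> R,
    (forall x, inI x -> derive_within_I f x (f' x)) /\ continuous_on_I f'.

(* Orientation-preserving C^1 diffeomorphism of [0,1] (values outside [0,1]
   are irrelevant). *)
Definition Diff1plus (f : R -> R) : Prop :=
  (forall x, inI x -> inI (f x)) /\ C1_on_I f /\
  (exists g : R -> R, (forall x, inI x -> inI (g x)) /\ C1_on_I g /\
     (forall x, inI x -> g (f x) = x) /\ (forall x, inI x -> f (g x) = x)) /\
  (forall x y, inI x -> inI y -> x <= y -> f x <= f y).

Definition eqI (f g : R -> R) : Prop := forall x, inI x -> f x = g x.

Definition hom_FZ (Phi : word -> R -> R) : Prop :=
  (forall w, Diff1plus (Phi w)) /\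
  eqI (Phi []) (fun x => x) /\
  (forall u v, eqI (Phi (u ++ v)) (fun x => Phi u (Phi v x))) /\
  (forall u v, wequiv u v -> eqI (Phi u) (Phi v)).

Definition injective_FZ (Phi : word -> R -> R) : Prop :=
  forall u v, eqI (Phi u) (Phi v) -> wequiv u v.

Definition inj_hom_F (iota : Fel -> word) : Prop :=
  (forall a b c : Fel, (forall x, Fval c x = Fval a (Fval b x)) ->
     wequiv (iota c) (iota a ++ iota b)) /\
  (forall a b : Fel, wequiv (iota a) (iota b) -> forall x, Fval a x = Fval b x).

Definition open_R (U : R -> Prop) : Prop :=
  forall x, U x -> exists eps, 0 < eps /\ forall y, Rabs (y - x) < eps -> U y.

Definition connected_R (A : R -> Prop) : Prop :=
  ~ exists U V : R -> Prop, open_R U /\ open_R V /\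
      (forall x, A x -> U x \/ V x) /\
      (exists x, A x /\ U x) /\ (exists x, A x /\ V x) /\
      (forall x, A x -> ~ (U x /\ V x)).

Definition component (S J : R -> Prop) : Prop :=
  (exists x, J x) /\ (forall x, J x -> S x) /\ connected_R J /\
  forall K, connected_R K -> (forall x, J x -> K x) -> (forall x, K x -> S x) ->
    forall x, K x -> J x.

Definition closure_R (J : R -> Prop) (x : R) : Prop :=
  forall eps, 0 < eps -> exists y, J y /\ Rabs (y - x) < eps.

Definition supp_action (Phi : word -> R -> R) (iota : Fel -> word) (x : R) : Prop :=
  inI x /\ exists g : Fel, Phi (iota g) x <> x.

Definition nonfaithful_on (Phi : word -> R -> R) (iota : Fel -> word)
  (J : R -> Prop) : Prop :=
  exists g : Fel, (exists x, Fval g x <> x) /\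
    forall x, J x -> Phi (iota g) x = x.

Definition semiconj_standard (Phi : word -> R -> R) (iota : Fel -> word)
  (J : R -> Prop) : Prop :=
  exists h : R -> R,
    let K := closure_R J in
    (forall x, K x -> inI (h x)) /\
    (forall y, inI y -> exists x, K x /\ h x = y) /\
    (forall x, K x -> forall eps, 0 < eps -> exists delta, 0 < delta /\
        forall y, K y -> Rabs (y - x) < delta -> Rabs (h y - h x) < eps) /\
    ((forall x y, K x -> K y -> x <= y -> h x <= h y) \/
     (forall x y, K x -> K y -> x <= y -> h y <= h x)) /\
    (forall (g : Fel) x, K x -> h (Phi (iota g) x) = Fval g (h x)).

(* Main.v *)
Require Import Defs.
From Stdlib Require Import Reals List ZArith Relations.
From Stdlib Require Import Lra Lia Classical IndefiniteDescription.
From Coquelicot Require Derive.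
Import ListNotations.
Open Scope R_scope.

(* An embedding of F acts on the components ("gaps") of its support, faithfully or
   not. On an unfaithful gap F acts through an abelian quotient. On a faithful one
   the action is semi-conjugate to the standard one, so some elements f, g of F map
   an interval to two disjoint subintervals of it; as f' and g' are continuous and
   take the value 1 on every gap, faithful gaps cannot be short, and there are
   finitely many of them.

   Take copies F_0, F_1, ... of F inside F with disjoint supports in the standard
   action, conjugate under one element, and let U_j be the union of the faithful
   gaps of F_j. As F_i permutes the finitely many faithful gaps of F_j, it fixes
   each of them, and a gap common to both would contain a point fixed by F_i,
   namely the top of the fibre over 1/2 of the semi-conjugacy for F_j. Hence the
   U_j are pairwise disjoint, and they have the same finite number n of components.
   Let t generate Z. For large j no endpoint of a component of t U_l, l <= n, lies
   in U_j, so if U_j meets all these t U_l, then each of them contains a component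
   of U_j, and these n + 1 components are distinct: a contradiction. So some U_j
   and t U_l are disjoint. Then commutators a in F_j and b in F_l are such that a
   and t b t^-1 have disjoint supports, thus commute, unlike in F * Z. *)

(** * Dyadic piecewise linear homeomorphisms *)

Lemma powerRZ2_pos (k : Z) : 0 < powerRZ 2 k.
Proof. apply powerRZ_lt; lra. Qed.

Lemma powerRZ2_opp (k : Z) : powerRZ 2 k * powerRZ 2 (- k) = 1.
Proof. rewrite <- powerRZ_add by lra. now rewrite Z.add_opp_diag_r. Qed.

Lemma dyadic_IZR (m : Z) : dyadic (IZR m).
Proof. exists m, 0%nat; simpl; field. Qed.

Lemma dyadic_add x y : dyadic x -> dyadic y -> dyadic (x + y).
Proof.
  intros [m [k ->]] [n [l ->]].
  exists (m * 2 ^ Z.of_nat l + n * 2 ^ Z.of_nat k)%Z, (k + l)%nat.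
  rewrite plus_IZR, !mult_IZR, <- !pow_IZR, pow_add.
  field; split; apply pow_nonzero; lra.
Qed.

Lemma dyadic_mul x y : dyadic x -> dyadic y -> dyadic (x * y).
Proof.
  intros [m [k ->]] [n [l ->]]. exists (m * n)%Z, (k + l)%nat.
  rewrite mult_IZR, pow_add. field; split; apply pow_nonzero; lra.
Qed.

Lemma dyadic_opp x : dyadic x -> dyadic (- x).
Proof.
  intros [m [k ->]]. exists (- m)%Z, k. rewrite opp_IZR.
  field; apply pow_nonzero; lra.
Qed.

Lemma dyadic_sub x y : dyadic x -> dyadic y -> dyadic (x - y).
Proof. intros; apply dyadic_add; [|apply dyadic_opp]; assumption. Qed.

Lemma dyadic_powerRZ (k : Z) : dyadic (powerRZ 2 k).
Proof.
  destruct (Z_le_gt_dec 0 k) as [H|H].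
  - exists (2 ^ k)%Z, 0%nat.
    rewrite <- (Z2Nat.id k) by assumption.
    rewrite <- pow_powerRZ, <- pow_IZR. simpl; field.
  - exists 1%Z, (Z.to_nat (- k)).
    rewrite pow_powerRZ, Z2Nat.id by lia.
    rewrite powerRZ_neg' , Rdiv_1_l, Rinv_inv. reflexivity.
Qed.

(** Some [2 ^ N] exceeds [1 / (y - x)], so the first multiple of [1 / 2 ^ N] after [x] comes before
    [y]. *)
Lemma dyadic_between x y : x < y -> exists d, dyadic d /\ x < d < y.
Proof.
  intros H.
  destruct (archimed_cor1 (y - x)) as [N [HN HN0]]; [lra|].
  assert (H2 : INR N < 2 ^ N).
  { clear. induction N; [simpl; lra|].
    rewrite S_INR. simpl. assert (1 <= 2 ^ N) by (apply pow_R1_Rle; lra). lra. }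
  assert (HNp : 0 < INR N) by (now apply lt_0_INR).
  assert (H3 : / 2 ^ N < y - x).
  { eapply Rlt_trans; [|exact HN]. apply Rinv_lt_contravar; [|exact H2].
    apply Rmult_lt_0_compat; lra. }
  exists (IZR (up (x * 2 ^ N)) / 2 ^ N). split; [now exists (up (x * 2 ^ N)), N|].
  destruct (archimed (x * 2 ^ N)) as [H4 H5].
  assert (H6 : 0 < 2 ^ N) by lra.
  split.
  - apply Rmult_lt_reg_r with (2 ^ N); [lra|].
    unfold Rdiv; rewrite Rmult_assoc, Rinv_l by lra. lra.
  - apply Rmult_lt_reg_r with (2 ^ N); [lra|].
    unfold Rdiv; rewrite Rmult_assoc, Rinv_l by lra.
    apply (Rmult_lt_compat_r (2 ^ N)) in H3; [|lra].
    rewrite Rinv_l in H3 by lra. lra.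
Qed.

Ltac dyadic_tac :=
  repeat first [ assumption | apply dyadic_IZR | apply dyadic_powerRZ
               | apply dyadic_add | apply dyadic_sub | apply dyadic_opp
               | apply dyadic_mul ].

Ltac dyadic_frac :=
  let go m k := solve [exists m, k; simpl; field] in
  first [ go 1%Z 1%nat | go 1%Z 2%nat | go 3%Z 2%nat
        | go 5%Z 3%nat | go 7%Z 3%nat | go 5%Z 4%nat | go 7%Z 4%nat
        | go 9%Z 4%nat | go 11%Z 4%nat ].

Definition affine_on (f : R -> R) (u v : R) (s : Z) : Prop :=
  forall x, u <= x <= v -> f x = f u + powerRZ 2 s * (x - u).

(** The list [D] need be neither sorted nor minimal, it only has to contain the breakpoints.
    Inverses, composites and gluings then just map and append lists. *)
Definition affine_off (D : list R) (f : R -> R) : Prop :=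
  forall u v, u < v -> (forall d, In d D -> d <= u \/ v <= d) ->
    exists s, affine_on f u v s.

(* On the whole line, so as to include the dyadic affine maps; [g] is the inverse
   of [f]. The elements of F are those which are the identity off [0,1]. *)
Definition PL (f g : R -> R) : Prop :=
  (forall x y, x < y -> f x < f y) /\
  (forall x, f (g x) = x) /\ (forall x, g (f x) = x) /\
  (forall x, dyadic x -> dyadic (f x)) /\ (forall x, dyadic x -> dyadic (g x)) /\
  exists D, (forall d, In d D -> dyadic d) /\ affine_off D f.

Section Increasing.

Variables f g : R -> R.
Hypothesis f_lt : forall x y, x < y -> f x < f y.
Hypothesis fg : forall x, f (g x) = x.
Hypothesis gf : forall x, g (f x) = x.

Lemma incr_le x y : x <= y -> f x <= f y.
Proof. intros [H| ->]; [left; auto|right; auto]. Qed.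

Lemma incr_lt_iff x y : f x < f y <-> x < y.
Proof.
  split; [|apply f_lt]. intros H. apply Rnot_le_lt. intros H1.
  apply incr_le in H1. lra.
Qed.

Lemma incr_inv_lt x y : x < y -> g x < g y.
Proof. intros H. apply incr_lt_iff. now rewrite !fg. Qed.

Lemma incr_bij_continuous x eps : 0 < eps ->
  exists delta, 0 < delta /\ forall y, Rabs (y - x) < delta -> Rabs (f y - f x) < eps.
Proof.
  intros Heps.
  assert (H1 : g (f x - eps) < x) by (rewrite <- (gf x) at 2; apply incr_inv_lt; lra).
  assert (H2 : x < g (f x + eps)) by (rewrite <- (gf x) at 1; apply incr_inv_lt; lra).
  exists (Rmin (x - g (f x - eps)) (g (f x + eps) - x)). split.
  - apply Rmin_pos; lra.
  - intros y Hy.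
    pose proof (Rmin_l (x - g (f x - eps)) (g (f x + eps) - x)).
    pose proof (Rmin_r (x - g (f x - eps)) (g (f x + eps) - x)).
    apply Rabs_def2 in Hy.
    assert (g (f x - eps) < y) as H3 by lra.
    assert (y < g (f x + eps)) as H4 by lra.
    apply f_lt in H3, H4. rewrite fg in H3, H4. apply Rabs_def1; lra.
Qed.

End Increasing.

(** The breakpoints are carried over by [f], and the exponents of the slopes change sign. *)
Lemma PL_inv f g : PL f g -> PL g f.
Proof.
  intros (Hlt & fg & gf & Hd & Hd' & D & HD & Ha).
  assert (Hg := incr_inv_lt f g Hlt fg).
  repeat split; auto.
  exists (map f D). split.
  - intros d Hi. apply in_map_iff in Hi as [e [<- He]]. auto.
  - intros u v Huv Hno.
    destruct (Ha (g u) (g v)) as [s Hs].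
    + now apply Hg.
    + intros d Hi. specialize (Hno (f d) (in_map f D d Hi)).
      destruct Hno as [H|H]; [left|right];
        rewrite <- (gf d); apply (incr_le g); auto.
    + exists (- s)%Z. intros x Hx.
      assert (Hgx : g u <= g x <= g v) by (split; apply incr_le; auto; lra).
      specialize (Hs _ Hgx). rewrite !fg in Hs.
      replace (x - u) with (powerRZ 2 s * (g x - g u)) by lra.
      rewrite <- Rmult_assoc, (Rmult_comm (powerRZ 2 (- s))), powerRZ2_opp. lra.
Qed.

(** Breakpoints come from [f2], or from [f1] by pulling back along [f2]; the exponents of the slopes
    add up. *)
Lemma PL_comp f1 g1 f2 g2 : PL f1 g1 -> PL f2 g2 ->
  PL (fun x => f1 (f2 x)) (fun x => g2 (g1 x)).
Proof.
  intros (Hlt & fg & gf & Hd & Hd' & D & HD & Ha)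
         (Hlt2 & fg2 & gf2 & Hd2 & Hd2' & D2 & HD2 & Ha2).
  repeat split; auto.
  - intros x. now rewrite fg2, fg.
  - intros x. now rewrite gf, gf2.
  - exists (D2 ++ map g2 D). split.
    + intros d Hi. apply in_app_iff in Hi as [Hi|Hi]; [auto|].
      apply in_map_iff in Hi as [e [<- He]]. auto.
    + intros u v Huv Hno.
      destruct (Ha2 u v Huv) as [s2 Hs2].
      { intros d Hi. apply Hno, in_app_iff. now left. }
      destruct (Ha (f2 u) (f2 v)) as [s Hs].
      { now apply Hlt2. }
      { intros d Hi. destruct (Hno (g2 d)) as [H|H].
        - apply in_app_iff. right. now apply in_map.
        - left. rewrite <- (fg2 d). now apply incr_le.
        - right. rewrite <- (fg2 d). now apply incr_le. }
      exists (s + s2)%Z. intros x Hx.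
      rewrite (Hs (f2 x)) by (split; apply incr_le; auto; lra).
      rewrite (Hs2 x Hx), powerRZ_add by lra. ring.
Qed.

Lemma PL_affine (k : Z) c : dyadic c ->
  PL (fun x => powerRZ 2 k * x + c) (fun x => powerRZ 2 (- k) * (x - c)).
Proof.
  intros Hc. pose proof (powerRZ2_pos k) as Hk. pose proof (powerRZ2_opp k) as Hk2.
  repeat split.
  - intros x y H. apply (Rmult_lt_compat_l (powerRZ 2 k)) in H; lra.
  - intros x. rewrite <- Rmult_assoc, Hk2. lra.
  - intros x. replace (powerRZ 2 k * x + c - c) with (powerRZ 2 k * x) by ring.
    rewrite <- Rmult_assoc, (Rmult_comm (powerRZ 2 (- k))), Hk2. lra.
  - intros x Hx. dyadic_tac.
  - intros x Hx. dyadic_tac.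
  - exists nil. split; [intros d []|].
    intros u v Huv _. exists k. intros x Hx. ring.
Qed.

Lemma PL_id : PL (fun x => x) (fun x => x).
Proof.
  repeat split; auto. exists nil. split; [intros d []|].
  intros u v _ _. exists 0%Z. intros x _. simpl. ring.
Qed.

Definition glue (c : R) (f g : R -> R) (x : R) : R :=
  if Rle_dec x c then f x else g x.

Lemma glue_l c f g x : x <= c -> glue c f g x = f x.
Proof. unfold glue; destruct Rle_dec; [reflexivity|lra]. Qed.

Lemma glue_r c f g x : f c = g c -> c <= x -> glue c f g x = g x.
Proof.
  intros E H. unfold glue; destruct Rle_dec; [|reflexivity].
  replace x with c by lra. exact E.
Qed.

(** An interval without [c] in its interior lies on one side of [c], so [c] is the only breakpoint
    to add. The inverse is glued at the image of [c]. *)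
Lemma PL_glue c f1 g1 f2 g2 : PL f1 g1 -> PL f2 g2 -> dyadic c -> f1 c = f2 c ->
  PL (glue c f1 f2) (glue (f1 c) g1 g2).
Proof.
  intros (Hlt & fg & gf & Hd & Hd' & D & HD & Ha)
         (Hlt2 & fg2 & gf2 & Hd2 & Hd2' & D2 & HD2 & Ha2) Hc E.
  assert (E' : g1 (f1 c) = g2 (f1 c)) by (now rewrite gf, E, gf2).
  assert (Hg1 := incr_inv_lt f1 g1 Hlt fg). assert (Hg2 := incr_inv_lt f2 g2 Hlt2 fg2).
  repeat split.
  - intros x y H. destruct (Rle_dec x c) as [Hx|Hx], (Rle_dec y c) as [Hy|Hy].
    + rewrite !glue_l by lra. auto.
    + rewrite (glue_l _ _ _ x), (glue_r _ _ _ y) by (auto; lra).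
      apply Rle_lt_trans with (f1 c); [now apply incr_le|].
      rewrite E. apply Hlt2. lra.
    + lra.
    + rewrite !glue_r by (auto; lra). auto.
  - intros x. destruct (Rle_dec x (f1 c)) as [Hx|Hx].
    + rewrite (glue_l (f1 c)) by lra. rewrite glue_l; [apply fg|].
      rewrite <- (gf c). apply incr_le; [assumption|lra].
    + rewrite (glue_r (f1 c)) by (auto; lra). rewrite glue_r; [apply fg2|auto|].
      rewrite <- (gf2 c). rewrite <- E.
      apply incr_le; [assumption|lra].
  - intros x. destruct (Rle_dec x c) as [Hx|Hx].
    + rewrite (glue_l c) by lra. rewrite glue_l; [apply gf|]. now apply incr_le.
    + rewrite (glue_r c) by (auto; lra). rewrite glue_r; [apply gf2|auto|].
      rewrite E. apply incr_le; [auto|lra].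
  - intros x Hx. unfold glue. destruct Rle_dec; auto.
  - intros x Hx. unfold glue. destruct Rle_dec; auto.
  - exists (c :: D ++ D2). split.
    + intros d [<-|Hi]; [assumption|]. apply in_app_iff in Hi as [Hi|Hi]; auto.
    + intros u v Huv Hno.
      destruct (Hno c (or_introl eq_refl)) as [H|H].
      * destruct (Ha2 u v Huv) as [s Hs].
        { intros d Hi. apply Hno. right. apply in_app_iff. now right. }
        exists s. intros x Hx. rewrite !glue_r by (auto; lra). auto.
      * destruct (Ha u v Huv) as [s Hs].
        { intros d Hi. apply Hno. right. apply in_app_iff. now left. }
        exists s. intros x Hx. rewrite !glue_l by lra. auto.
Qed.

Lemma dyadic_common (D : list R) : (forall d, In d D -> dyadic d) ->
  exists N : nat, forall d, In d D -> exists m : Z, d = IZR m / 2 ^ N.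
Proof.
  induction D as [|e D IH]; intros HD; [exists 0%nat; intros d []|].
  destruct IH as [N HN]; [intros; apply HD; now right|].
  destruct (HD e (or_introl eq_refl)) as [m [k Hm]].
  assert (Hnz : forall j, 2 ^ j <> 0) by (intros; apply pow_nonzero; lra).
  exists (N + k)%nat. intros d [<-|Hi].
  - exists (m * 2 ^ Z.of_nat N)%Z.
    rewrite mult_IZR, <- pow_IZR, pow_add, Hm. field; auto.
  - destruct (HN d Hi) as [m' ->]. exists (m' * 2 ^ Z.of_nat k)%Z.
    rewrite mult_IZR, <- pow_IZR, pow_add. field; auto.
Qed.

Lemma PL_fix_01 f g : PL f g -> (forall x, ~ inI x -> f x = x) ->
  f 0 = 0 /\ f 1 = 1 /\ forall x, ~ inI x -> g x = x.
Proof.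
  intros (Hlt & fg & gf & _) Ho.
  assert (Hgo : forall x, ~ inI x -> g x = x).
  { intros x Hx. rewrite <- (Ho x Hx) at 1. apply gf. }
  (* If [h 0] were negative, it would lie outside [0,1] and be fixed, so [h] would agree at 0 and at
     [h 0]; likewise at 1. *)
  assert (Hmid : forall h : R -> R, (forall x y, x < y -> h x < h y) ->
            (forall x, ~ inI x -> h x = x) -> 0 <= h 0 /\ h 1 <= 1).
  { intros h Hh Hho. unfold inI in Hho. split; apply Rnot_lt_le; intros H.
    - assert (H1 := Hh (h 0) 0 H). rewrite Hho in H1 by lra. lra.
    - assert (H1 := Hh 1 (h 1) H). rewrite (Hho (h 1)) in H1 by lra. lra. }
  assert (Hg := incr_inv_lt f g Hlt fg).
  destruct (Hmid f Hlt Ho) as [H1 H2], (Hmid g Hg Hgo) as [H3 H4].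
  apply (incr_le f Hlt) in H3, H4. rewrite fg in H3, H4.
  repeat split; auto; lra.
Qed.

Lemma PL_isF f g : PL f g -> (forall x, ~ inI x -> f x = x) -> isF f.
Proof.
  intros HPL Ho. destruct (PL_fix_01 f g HPL Ho) as (H0 & H1 & Hgo).
  destruct HPL as (Hlt & fg & gf & _ & _ & D & HD & Ha).
  assert (Hg := incr_inv_lt f g Hlt fg).
  assert (g0 : g 0 = 0) by (rewrite <- H0 at 1; apply gf).
  assert (g1 : g 1 = 1) by (rewrite <- H1 at 1; apply gf).
  split; [|split; [exact Ho|]].
  - assert (HI : forall h : R -> R, (forall x y, x < y -> h x < h y) ->
              h 0 = 0 -> h 1 = 1 -> forall x, inI x -> inI (h x)).
    { intros h Hh E0 E1 x [Hx1 Hx2].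
      apply (incr_le h Hh) in Hx1, Hx2. unfold inI; lra. }
    split; [now apply HI|]. split.
    + intros x _ eps Heps.
      destruct (incr_bij_continuous f g Hlt fg gf x eps Heps) as [d [Hd H]].
      exists d. auto.
    + exists g. repeat split; auto; try (now apply HI).
      intros x _ eps Heps.
      destruct (incr_bij_continuous g f Hg gf fg x eps Heps) as [d [Hd H]].
      exists d. auto.
  - destruct (dyadic_common D HD) as [N HN].
    assert (HNp : 0 < 2 ^ N) by (apply pow_lt; lra).
    (* As [2 ^ N] is a common denominator of [D], no cell of this uniform grid has a point of [D] in
       its interior. *)
    set (p := fun i : nat => INR i / 2 ^ N).
    assert (Hpi : forall i, p i < p (S i)).
    { intros i. unfold p. apply Rmult_lt_compat_r; [now apply Rinv_0_lt_compat|].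
      rewrite S_INR. lra. }
    assert (Hs : forall i, exists s, affine_on f (p i) (p (S i)) s).
    { intros i. apply Ha; [apply Hpi|].
      intros d Hi. destruct (HN d Hi) as [m ->]. unfold p.
      rewrite !INR_IZR_INZ.
      assert (0 <= / 2 ^ N) by (left; now apply Rinv_0_lt_compat).
      destruct (Z_le_gt_dec m (Z.of_nat i)) as [H'|H']; [left|right];
        (apply Rmult_le_compat_r; [assumption|apply IZR_le; lia]). }
    destruct (functional_choice _ Hs) as [s Hs'].
    exists (2 ^ N)%nat, p, s. repeat split.
    + unfold p. simpl. lra.
    + unfold p. rewrite pow_INR, (INR_IZR_INZ 2). simpl IZR. field. lra.
    + auto.
    + intros i _. exists (Z.of_nat i), N. unfold p. now rewrite INR_IZR_INZ.
    + intros i _. apply Hs'.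
Qed.

Section Partition.

Variables (n : nat) (p : nat -> R).
Hypothesis p0 : p 0%nat = 0.
Hypothesis pn : p n = 1.

Lemma partition_piece u : 0 <= u < 1 ->
  exists i, (i < n)%nat /\ p i <= u < p (S i).
Proof.
  intros Hu.
  assert (H : forall k, (k <= n)%nat -> u < p k ->
                exists i, (i < k)%nat /\ p i <= u < p (S i)).
  { induction k as [|k IH]; intros Hk Huk; [rewrite p0 in Huk; lra|].
    destruct (Rlt_le_dec u (p k)) as [H|H].
    - destruct IH as [i [Hi Hi']]; [lia|exact H|]. exists i; split; [lia|exact Hi'].
    - exists k. split; [lia|lra]. }
  apply H; [lia|rewrite pn; lra].
Qed.

End Partition.

Lemma isF_PL f : isF f -> exists g, PL f g.
Proof.
  intros [(HfI & _ & g0 & Hg0I & _ & g0f & fg0) [Ho (n & p & s & p0 & pn & Hp & Hpd & Hs)]].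
  assert (Hpos := powerRZ2_pos).
  assert (HpI : forall i, (i <= n)%nat -> 0 <= p i <= 1).
  { assert (Hmono : forall i j, (i + j <= n)%nat -> p i <= p (i + j)%nat).
    { intros i j; induction j as [|j IH]; intros Hj; [rewrite Nat.add_0_r; lra|].
      rewrite Nat.add_succ_r. specialize (Hp (i + j)%nat).
      assert (p i <= p (i + j)%nat) by (apply IH; lia).
      assert (p (i + j)%nat < p (S (i + j))) by (apply Hp; lia). lra. }
    intros i Hi. split.
    - rewrite <- p0. apply (Hmono 0%nat i). lia.
    - rewrite <- pn. replace n with (i + (n - i))%nat at 1 by lia. apply Hmono; lia. }
  assert (Hpiece : forall i x y, (i < n)%nat -> p i <= x -> x < y -> y <= p (S i) -> f x < f y).
  { intros i x y Hi H1 H2 H3. rewrite (Hs i Hi x), (Hs i Hi y) by lra.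
    assert (powerRZ 2 (s i) * (x - p i) < powerRZ 2 (s i) * (y - p i)); [|lra].
    apply Rmult_lt_compat_l; [auto|lra]. }
  assert (Hinc : forall i, (i <= n)%nat -> forall x y, 0 <= x -> x < y -> y <= p i -> f x < f y).
  { induction i as [|i IH]; intros Hi x y Hx Hxy Hy; [rewrite p0 in Hy; lra|].
    destruct (Rle_dec y (p i)) as [H|H]; [apply IH; auto; lia|].
    destruct (Rle_dec (p i) x) as [H'|H']; [apply (Hpiece i); auto; lia|].
    apply Rlt_trans with (f (p i)); [apply IH; try lia; lra|].
    apply (Hpiece i); try lia; lra. }
  assert (HincI : forall x y, inI x -> inI y -> x < y -> f x < f y).
  { unfold inI; intros x y Hx Hy Hxy. apply (Hinc n); [lia|lra|lra|rewrite pn; lra]. }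
  assert (I0 : inI 0) by (unfold inI; lra). assert (I1 : inI 1) by (unfold inI; lra).
  assert (f0 : f 0 = 0).
  { destruct (Req_dec (g0 0) 0) as [H|H]; [rewrite <- H at 1; auto|].
    assert (H1 : f 0 < f (g0 0)) by (apply HincI; auto; destruct (Hg0I 0 I0); lra).
    rewrite fg0 in H1 by auto. destruct (HfI 0 I0); lra. }
  assert (f1 : f 1 = 1).
  { destruct (Req_dec (g0 1) 1) as [H|H]; [rewrite <- H at 1; auto|].
    assert (H1 : f (g0 1) < f 1) by (apply HincI; auto; destruct (Hg0I 1 I1); lra).
    rewrite fg0 in H1 by auto. destruct (HfI 1 I1); lra. }
  assert (dI : forall x, {inI x} + {~ inI x}).
  { intros x. unfold inI. destruct (Rle_dec 0 x), (Rle_dec x 1); [left|right|right|right]; lra. }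
  (* The inverse given by [homeo_I] is arbitrary outside [0,1], hence the correction. *)
  pose (g := fun x => if dI x then g0 x else x).
  assert (Hlt : forall x y, x < y -> f x < f y).
  { intros x y Hxy. destruct (dI x) as [Hx|Hx], (dI y) as [Hy|Hy].
    - auto.
    - rewrite (Ho y Hy). pose proof (HfI x Hx). unfold inI in *. lra.
    - rewrite (Ho x Hx). pose proof (HfI y Hy). unfold inI in *. lra.
    - rewrite (Ho x Hx), (Ho y Hy). lra. }
  assert (fg : forall x, f (g x) = x).
  { intros x. unfold g. destruct (dI x); auto. }
  assert (gf : forall x, g (f x) = x).
  { intros x. unfold g. destruct (dI x) as [Hx|Hx].
    - pose proof (HfI x Hx). destruct (dI (f x)); [auto|contradiction].
    - rewrite (Ho x Hx). destruct (dI x); [contradiction|auto]. }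
  (* From [f 0 = 0] on, each piece adds a power of 2 times a dyadic length. *)
  assert (Hfp : forall i, (i <= n)%nat -> dyadic (f (p i))).
  { induction i as [|i IH]; intros Hi; [rewrite p0, f0; apply (dyadic_IZR 0)|].
    assert (Hi' : (i < n)%nat) by lia.
    rewrite (Hs i Hi' (p (S i))) by (specialize (Hp i Hi'); lra).
    assert (dyadic (f (p i))) by (apply IH; lia).
    assert (dyadic (p i)) by (apply Hpd; lia).
    assert (dyadic (p (S i))) by (now apply Hpd). dyadic_tac. }
  assert (Hdy : forall x, dyadic x <-> dyadic (f x)).
  { intros x. destruct (dI x) as [Hx|Hx]; [|rewrite (Ho x Hx); tauto].
    destruct (Req_dec x 1) as [->|Hx1]; [rewrite f1; tauto|].
    destruct (partition_piece n p p0 pn x) as [i [Hi Hxi]]; [unfold inI in Hx; lra|].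
    assert (E := Hs i Hi x (conj (proj1 Hxi) (Rlt_le _ _ (proj2 Hxi)))).
    assert (dyadic (f (p i))) by (apply Hfp; lia).
    assert (dyadic (p i)) by (apply Hpd; lia).
    split; intros Hd.
    - rewrite E. dyadic_tac.
    - replace x with (p i + powerRZ 2 (- s i) * (f x - f (p i))); [dyadic_tac|].
      rewrite E.
      replace (f (p i) + powerRZ 2 (s i) * (x - p i) - f (p i))
        with (powerRZ 2 (s i) * (x - p i)) by ring.
      rewrite <- Rmult_assoc, (Rmult_comm (powerRZ 2 (- s i))), powerRZ2_opp. ring. }
  exists g. repeat split; auto.
  - intros x. apply Hdy.
  - intros x Hx. apply (Hdy (g x)). now rewrite fg.
  - exists (map p (seq 0 (S n))). split.
    { intros d Hd. apply in_map_iff in Hd as [i [<- Hi]].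
      apply in_seq in Hi. apply Hpd. lia. }
    intros u v Huv Hno.
    assert (Hno' : forall i, (i <= n)%nat -> p i <= u \/ v <= p i).
    { intros i Hi. apply Hno, in_map, in_seq. lia. }
    destruct (Hno' 0%nat) as [H0|H0]; [lia| |]; rewrite p0 in H0.
    + destruct (Hno' n) as [H1|H1]; [lia| |]; rewrite pn in H1.
      * exists 0%Z. intros x Hx. simpl.
        assert (Hid : forall z, 1 <= z -> f z = z).
        { intros z [Hz| <-]; [apply Ho; unfold inI; lra|assumption]. }
        rewrite !Hid by lra. ring.
      * destruct (partition_piece n p p0 pn u) as [i [Hi Hui]]; [lra|].
        destruct (Hno' (S i)) as [H2|H2]; [lia|lra|].
        exists (s i). intros x Hx. rewrite (Hs i Hi x), (Hs i Hi u) by lra. ring.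
    + exists 0%Z. intros x Hx. simpl.
      assert (Hid : forall z, z <= 0 -> f z = z).
      { intros z [Hz| ->]; [apply Ho; unfold inI; lra|assumption]. }
      rewrite !Hid by lra. ring.
Qed.

(** * Interpolation of dyadic points *)

(** One affine piece only stretches by powers of 2. In the induction the previous map is run at
    double speed on [0, 1/2], and slope 2 on [1/2, 1] adds one more unit of length. *)
Lemma PL_nat_length (m : nat) : exists f g, PL f g /\ f 0 = 0 /\ f 1 = INR (S m).
Proof.
  induction m as [|m (f & g & Hfg & H0 & H1)].
  - exists (fun x => x), (fun x => x). split; [apply PL_id|simpl; lra].
  - assert (Hm : dyadic (INR (S m) - 1)).
    { rewrite INR_IZR_INZ. dyadic_tac. }
    pose proof (PL_comp _ _ _ _ Hfg (PL_affine 1 0 (dyadic_IZR 0))) as P1.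
    pose proof (PL_affine 1 _ Hm) as P2.
    eexists _, _. split.
    + apply (PL_glue (/ 2) _ _ _ _ P1 P2).
      * exists 1%Z, 1%nat. simpl. field.
      * replace (powerRZ 2 1 * / 2 + 0) with 1 by (simpl; field).
        rewrite H1. simpl powerRZ. field.
    + split.
      * rewrite glue_l by lra. now rewrite Rmult_0_r, Rplus_0_r.
      * rewrite glue_r; [|
          replace (powerRZ 2 1 * / 2 + 0) with 1 by (simpl; field);
          rewrite H1; simpl powerRZ; field | lra].
        rewrite (S_INR (S m)). simpl powerRZ. ring.
Qed.

Lemma PL_length r : dyadic r -> 0 < r -> exists f g, PL f g /\ f 0 = 0 /\ f 1 = r.
Proof.
  intros [m [k ->]] Hr.
  assert (Hk : 0 < 2 ^ k) by (apply pow_lt; lra).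
  assert (Hm : 0 < IZR m).
  { apply (Rmult_lt_compat_r (2 ^ k)) in Hr; [|exact Hk].
    unfold Rdiv in Hr. rewrite Rmult_assoc, Rinv_l in Hr; lra. }
  apply lt_IZR in Hm.
  destruct (PL_nat_length (Z.to_nat m - 1)) as (f & g & Hfg & H0 & H1).
  eexists _, _. split; [|split].
  - apply (PL_comp _ _ _ _ (PL_affine (- Z.of_nat k) 0 (dyadic_IZR 0)) Hfg).
  - simpl. rewrite H0. ring.
  - simpl. rewrite H1.
    replace (S (Z.to_nat m - 1)) with (Z.to_nat m) by lia.
    rewrite INR_IZR_INZ, Z2Nat.id by lia.
    rewrite powerRZ_neg', <- pow_powerRZ. unfold Rdiv. ring.
Qed.

(** The map passes through [0,1]: translation, an inverse stretching, a stretching and another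
    translation. *)
Lemma PL_interval a b c d : dyadic a -> dyadic b -> dyadic c -> dyadic d ->
  a < b -> c < d -> exists f g, PL f g /\ f a = c /\ f b = d.
Proof.
  intros Ha Hb Hc Hd Hab Hcd.
  destruct (PL_length (b - a)) as (f1 & g1 & P1 & E1 & E1'); [dyadic_tac|lra|].
  destruct (PL_length (d - c)) as (f2 & g2 & P2 & E2 & E2'); [dyadic_tac|lra|].
  pose proof (PL_affine 0 _ (dyadic_opp _ Ha)) as Pa.
  pose proof (PL_affine 0 _ Hc) as Pc.
  assert (gf1 : forall x, g1 (f1 x) = x) by (apply P1).
  eexists _, _. split; [|split].
  - exact (PL_comp _ _ _ _ Pc (PL_comp _ _ _ _ P2 (PL_comp _ _ _ _ (PL_inv _ _ P1) Pa))).
  - simpl. replace (1 * a + - a) with (f1 0) by (rewrite E1; ring).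
    rewrite gf1, E2. ring.
  - simpl. replace (1 * b + - a) with (f1 1) by (rewrite E1'; ring).
    rewrite gf1, E2'. ring.
Qed.

(** This is the source of all explicit elements of F below. Five pieces meeting at 0, [a], [b], 1
    are glued from the right, the outer two being the identity. *)
Lemma F_two_point a b c d : dyadic a -> dyadic b -> dyadic c -> dyadic d ->
  0 < a < b -> b < 1 -> 0 < c < d -> d < 1 ->
  exists f : Fel, Fval f a = c /\ Fval f b = d.
Proof.
  intros Ha Hb Hc Hd Hab Hb1 Hcd Hd1.
  pose proof (dyadic_IZR 0) as D0. pose proof (dyadic_IZR 1) as D1.
  destruct (PL_interval 0 a 0 c) as (f1 & g1 & P1 & E1 & E1'); auto; try lra.
  destruct (PL_interval a b c d) as (f2 & g2 & P2 & E2 & E2'); auto; try lra.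
  destruct (PL_interval b 1 d 1) as (f3 & g3 & P3 & E3 & E3'); auto; try lra.
  assert (Q4 : f3 1 = 1) by lra.
  pose proof (PL_glue 1 _ _ _ _ P3 PL_id D1 Q4) as P4.
  assert (Q5 : f2 b = glue 1 f3 (fun x => x) b) by (rewrite glue_l; lra).
  pose proof (PL_glue b _ _ _ _ P2 P4 Hb Q5) as P5.
  assert (Q6 : f1 a = glue b f2 (glue 1 f3 (fun x => x)) a) by (rewrite glue_l; lra).
  pose proof (PL_glue a _ _ _ _ P1 P5 Ha Q6) as P6.
  assert (Q7 : 0 = glue a f1 (glue b f2 (glue 1 f3 (fun x => x))) 0) by (rewrite glue_l; lra).
  pose proof (PL_glue 0 _ _ _ _ PL_id P6 D0 Q7) as P7.
  assert (HF := PL_isF _ _ P7).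
  assert (Ho : forall x, ~ inI x -> glue 0 (fun x => x)
     (glue a f1 (glue b f2 (glue 1 f3 (fun x => x)))) x = x).
  { intros x Hx. destruct (Rle_dec x 0) as [H|H]; [now apply glue_l|].
    assert (1 < x) by (unfold inI in Hx; lra).
    rewrite !glue_r; auto; lra. }
  exists (exist _ _ (HF Ho)). unfold Fval; simpl. split.
  - rewrite glue_r; [|exact Q7|lra]. rewrite glue_l by lra. lra.
  - rewrite glue_r; [|exact Q7|lra]. rewrite glue_r; [|exact Q6|lra].
    rewrite glue_l by lra. lra.
Qed.

(** * The group F and its elements with disjoint supports *)

Lemma Fel_PL (a : Fel) : exists g, PL (Fval a) g.
Proof. apply isF_PL, (proj2_sig a). Qed.

Lemma Fval_lt (a : Fel) x y : x < y -> Fval a x < Fval a y.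
Proof. destruct (Fel_PL a) as [g Hg]. apply Hg. Qed.

Lemma Fval_inj (a : Fel) x y : Fval a x = Fval a y -> x = y.
Proof.
  intros E. destruct (Rtotal_order x y) as [H|[H|H]]; [|exact H|];
    apply (Fval_lt a) in H; lra.
Qed.

Lemma Fval_out (a : Fel) x : ~ inI x -> Fval a x = x.
Proof. apply (proj2_sig a). Qed.

Lemma Fval_01 (a : Fel) : Fval a 0 = 0 /\ Fval a 1 = 1.
Proof.
  destruct (Fel_PL a) as [g Hg].
  destruct (PL_fix_01 _ _ Hg (Fval_out a)) as (H0 & H1 & _). auto.
Qed.

Lemma Fel_of_PL f g : PL f g -> (forall x, ~ inI x -> f x = x) ->
  exists c : Fel, forall x, Fval c x = f x.
Proof. intros P Ho. exists (exist _ f (PL_isF f g P Ho)). reflexivity. Qed.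

Lemma Fcomp_ex (a b : Fel) : exists c : Fel, forall x, Fval c x = Fval a (Fval b x).
Proof.
  destruct (Fel_PL a) as [ga Ha], (Fel_PL b) as [gb Hb].
  apply (Fel_of_PL _ _ (PL_comp _ _ _ _ Ha Hb)).
  intros x Hx. now rewrite (Fval_out b), (Fval_out a).
Qed.

Lemma Finv_ex (a : Fel) : exists c : Fel,
  forall x, Fval a (Fval c x) = x /\ Fval c (Fval a x) = x.
Proof.
  destruct (Fel_PL a) as [g Ha].
  destruct (Fel_of_PL g _ (PL_inv _ _ Ha)) as [c Hc].
  { apply (PL_fix_01 _ _ Ha (Fval_out a)). }
  exists c. intros x. rewrite !Hc. split; apply Ha.
Qed.

(** Elements of F carry proofs and are therefore compared by their values. The operations are
    obtained by choice and used only through their values. *)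
Definition fcomp (a b : Fel) : Fel :=
  proj1_sig (constructive_indefinite_description _ (Fcomp_ex a b)).

Definition finv (a : Fel) : Fel :=
  proj1_sig (constructive_indefinite_description _ (Finv_ex a)).

Lemma fcompE a b x : Fval (fcomp a b) x = Fval a (Fval b x).
Proof. unfold fcomp. destruct constructive_indefinite_description; simpl; auto. Qed.

Lemma finvK a x : Fval a (Fval (finv a) x) = x.
Proof. unfold finv. destruct constructive_indefinite_description as [c H]; simpl; apply H. Qed.

Lemma finvKl a x : Fval (finv a) (Fval a x) = x.
Proof. unfold finv. destruct constructive_indefinite_description as [c H]; simpl; apply H. Qed.

(* The copy of [g] supported in [1/4, 1/2]. *)
Lemma Fquarter_ex (g : Fel) : exists c : Fel,
  forall x, Fval c x = / 4 * Fval g (4 * x - 1) + / 4.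
Proof.
  destruct (Fel_PL g) as [g' Hg].
  assert (D1 : dyadic (/ 4)) by (exists 1%Z, 2%nat; simpl; field).
  destruct (Fel_of_PL _ _ (PL_comp _ _ _ _ (PL_affine (-2) _ D1)
    (PL_comp _ _ _ _ Hg (PL_affine 2 (-1) (dyadic_IZR (-1)))))) as [c Hc].
  - intros x Hx. rewrite Fval_out.
    + simpl. field.
    + unfold inI in *. simpl. lra.
  - exists c. intros x. rewrite Hc. simpl.
    replace (2 * (2 * 1) * x + -1) with (4 * x - 1) by ring.
    replace (/ (2 * (2 * 1))) with (/ 4) by (f_equal; ring). reflexivity.
Qed.

Definition fquarter (g : Fel) : Fel :=
  proj1_sig (constructive_indefinite_description _ (Fquarter_ex g)).

Lemma fquarterE g x : Fval (fquarter g) x = / 4 * Fval g (4 * x - 1) + / 4.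
Proof. unfold fquarter. destruct constructive_indefinite_description; simpl; auto. Qed.

Lemma fquarter_comp a b x :
  Fval (fquarter a) (Fval (fquarter b) x) = / 4 * Fval a (Fval b (4 * x - 1)) + / 4.
Proof. rewrite !fquarterE. do 3 f_equal. field. Qed.

Lemma fquarter_out g x : x <= / 4 \/ / 2 <= x -> Fval (fquarter g) x = x.
Proof.
  intros H. rewrite fquarterE.
  assert (E : Fval g (4 * x - 1) = 4 * x - 1).
  { destruct (Req_dec (4 * x - 1) 0) as [->|H0]; [apply Fval_01|].
    destruct (Req_dec (4 * x - 1) 1) as [->|H1]; [apply Fval_01|].
    apply Fval_out. unfold inI. lra. }
  rewrite E. field.
Qed.

(** If [f] fixes [x], then at [g x] either [f] is trivial, as desired, or [g] is, and then [g x = x]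
    by injectivity. The set [S] allows for maps controlled only on [0,1]. *)
Lemma commute_of_disjoint (A : Type) (f g : A -> A) (S : A -> Prop) :
  (forall x y, S x -> S y -> f x = f y -> x = y) ->
  (forall x y, S x -> S y -> g x = g y -> x = y) ->
  (forall x, S x -> S (f x)) -> (forall x, S x -> S (g x)) ->
  (forall x, S x -> f x = x \/ g x = x) ->
  forall x, S x -> f (g x) = g (f x).
Proof.
  intros If Ig Sf Sg D x Hx.
  destruct (D x Hx) as [E|E]; rewrite E.
  - destruct (D (g x) (Sg x Hx)) as [E'|E']; [exact E'|].
    apply Ig in E'; auto. now rewrite E'.
  - destruct (D (f x) (Sf x Hx)) as [E'|E']; [|now symmetry].
    apply If in E'; auto. now rewrite E'.
Qed.

Lemma Fval_commute_of_disjoint (a b : Fel) :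
  (forall x, Fval a x = x \/ Fval b x = x) ->
  forall x, Fval a (Fval b x) = Fval b (Fval a x).
Proof.
  intros H x. apply (commute_of_disjoint R (Fval a) (Fval b) (fun _ => True)); auto.
  - intros u v _ _. apply Fval_inj.
  - intros u v _ _. apply Fval_inj.
Qed.

(** If [x < g x], take a dyadic [d] between them. Then [g^-1 d < x < d], and any dyadic [c] between
    [g^-1 d] and [d] is sent beyond [d]. The other case is symmetric. *)
Lemma F_nontrivial_pushes (g : Fel) : (exists x, Fval g x <> x) ->
  exists c d, dyadic c /\ dyadic d /\ 0 < c < d /\ d < 1 /\
    (d < Fval g c \/ Fval g d < c).
Proof.
  intros [x Hx].
  assert (HI : 0 < x < 1).
  { destruct (Fval_01 g) as [E0 E1]. split; apply Rnot_le_lt; intros H; apply Hx;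
      destruct H as [H|H]; try (apply Fval_out; unfold inI; lra).
    - now subst.
    - now rewrite <- H. }
  destruct (Fval_01 g) as [E0 E1], (Fval_01 (finv g)) as [E0' E1'].
  pose proof (Fval_lt g 0 x ltac:(lra)). pose proof (Fval_lt g x 1 ltac:(lra)).
  destruct (Rtotal_order x (Fval g x)) as [H1|[H1|H1]]; [|congruence|].
  - destruct (dyadic_between _ _ H1) as [d [Dd [Hd1 Hd2]]].
    assert (H2 : Fval (finv g) d < d).
    { apply Rlt_trans with x; [|assumption].
      rewrite <- (finvKl g x). now apply Fval_lt. }
    destruct (dyadic_between _ _ H2) as [c [Dc [Hc1 Hc2]]].
    exists c, d. repeat split; auto; try lra.
    + pose proof (Fval_lt (finv g) 0 d ltac:(lra)). lra.
    + left. rewrite <- (finvK g d). now apply Fval_lt.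
  - destruct (dyadic_between _ _ H1) as [c [Dc [Hc1 Hc2]]].
    assert (H2 : c < Fval (finv g) c).
    { apply Rlt_trans with x; [assumption|].
      rewrite <- (finvKl g x). now apply Fval_lt. }
    destruct (dyadic_between _ _ H2) as [d [Dd [Hd1 Hd2]]].
    exists c, d. repeat split; auto; try lra.
    + pose proof (Fval_lt (finv g) c 1 ltac:(lra)). lra.
    + right. rewrite <- (finvK g c). now apply Fval_lt.
Qed.

(** The element [k] carries [1/4, 1/2] onto an interval [c, d] which [g] pushes off itself. *)
Lemma F_conj_moves_quarter (g : Fel) : (exists x, Fval g x <> x) ->
  exists k : Fel, let g' := fcomp (finv k) (fcomp g k) in
    / 2 <= Fval g' (/ 4) \/ Fval g' (/ 2) <= / 4.
Proof.
  intros Hg. destruct (F_nontrivial_pushes g Hg) as (c & d & Dc & Dd & Hcd & Hd & H).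
  destruct (F_two_point (/ 4) (/ 2) c d) as [k [K1 K2]]; auto; try lra;
    [dyadic_frac|dyadic_frac|].
  exists k. simpl. rewrite !fcompE, K1, K2.
  destruct H as [H|H]; [left|right]; apply (Fval_lt (finv k)) in H; left.
  - rewrite <- (finvKl k (/ 2)) at 1. now rewrite K2.
  - rewrite <- (finvKl k (/ 4)) at 1. now rewrite K1.
Qed.

(* Conjugating by [k] one may assume that [g] moves [1/4, 1/2] off itself; then
   [g b g^-1] commutes with [b'] for all [b, b'] supported in [1/4, 1/2]. This is
   what forces a normal subgroup containing [g] to contain their commutator. *)
Lemma F_conj_commutes (g : Fel) : (exists x, Fval g x <> x) ->
  exists k : Fel, let g' := fcomp (finv k) (fcomp g k) in
    forall b b' : Fel, let c := fcomp g' (fcomp (fquarter b) (finv g')) in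
      forall x, Fval c (Fval (fquarter b') x) = Fval (fquarter b') (Fval c x).
Proof.
  intros Hg. destruct (F_conj_moves_quarter g Hg) as [k Hk].
  exists k. intros g' b b' c. fold g' in Hk. apply Fval_commute_of_disjoint.
  intros x.
  destruct (Rle_dec x (/ 4)) as [H1|H1]; [right; apply fquarter_out; now left|].
  destruct (Rle_dec (/ 2) x) as [H2|H2]; [right; apply fquarter_out; now right|].
  left. unfold c. rewrite !fcompE, fquarter_out; [apply finvK|].
  destruct Hk as [Hk|Hk]; [left|right].
  - rewrite <- (finvKl g' (/ 4)). left. apply Fval_lt. lra.
  - rewrite <- (finvKl g' (/ 2)). left. apply Fval_lt. lra.
Qed.

(** * Copies of F with disjoint supports *)

(** The image [5/8, 3/4] of [1/4, 1/2] lies strictly to its right, so that the images under all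
    powers are disjoint. *)
Definition shift_el : Fel := proj1_sig (constructive_indefinite_description _
  (F_two_point (/ 4) (/ 2) (5 / 8) (3 / 4) ltac:(dyadic_frac) ltac:(dyadic_frac)
     ltac:(dyadic_frac) ltac:(dyadic_frac) ltac:(lra) ltac:(lra) ltac:(lra) ltac:(lra))).

Lemma shift_el_val : Fval shift_el (/ 4) = 5 / 8 /\ Fval shift_el (/ 2) = 3 / 4.
Proof. unfold shift_el. destruct constructive_indefinite_description; auto. Qed.

Definition fid : Fel := fcomp shift_el (finv shift_el).

Lemma fidE x : Fval fid x = x.
Proof. unfold fid. rewrite fcompE. apply finvK. Qed.

Fixpoint fpow (a : Fel) (j : nat) : Fel :=
  match j with O => fid | S j => fcomp a (fpow a j) end.

(* The copy of F supported in [gamma^j [1/4, 1/2]], where [gamma = shift_el]. *)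
Definition Fcopy (j : nat) (g : Fel) : Fel :=
  fcomp (fpow shift_el j) (fcomp (fquarter g) (finv (fpow shift_el j))).

Lemma Fcopy_out j g x :
  x <= Fval (fpow shift_el j) (/ 4) \/ Fval (fpow shift_el j) (/ 2) <= x ->
  Fval (Fcopy j g) x = x.
Proof.
  intros H. unfold Fcopy. set (k := fpow shift_el j) in *. rewrite !fcompE.
  rewrite fquarter_out; [apply finvK|].
  assert (Hle := incr_le (Fval (finv k)) (Fval_lt (finv k))).
  destruct H as [H|H]; [left|right]; apply Hle in H; now rewrite finvKl in H.
Qed.

(** Since [1/2 < 5/8 = gamma (1/4)], applying [gamma^k] compares consecutive intervals; then
    induct. *)
Lemma fpow_shift_lt i j : (i < j)%nat ->
  Fval (fpow shift_el i) (/ 2) < Fval (fpow shift_el j) (/ 4).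
Proof.
  destruct shift_el_val as [E1 E2].
  assert (Hcomm : forall j x, Fval shift_el (Fval (fpow shift_el j) x)
                  = Fval (fpow shift_el j) (Fval shift_el x)).
  { clear. induction j as [|j IH]; intros x; simpl.
    - now rewrite !fidE.
    - now rewrite !fcompE, IH. }
  assert (Hstep : forall i, Fval (fpow shift_el i) (/ 2) < Fval (fpow shift_el (S i)) (/ 4)).
  { intros k. simpl. rewrite fcompE, Hcomm, E1. apply Fval_lt. lra. }
  induction 1 as [|m Hm IH]; [apply Hstep|].
  eapply Rlt_trans; [exact IH|]. eapply Rlt_trans; [|apply Hstep].
  apply Fval_lt. lra.
Qed.

Lemma Fcopy_commute i j a b : i <> j ->
  forall x, Fval (Fcopy i a) (Fval (Fcopy j b) x) = Fval (Fcopy j b) (Fval (Fcopy i a) x).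
Proof.
  intros Hij. apply Fval_commute_of_disjoint. intros x.
  destruct (Rle_dec x (Fval (fpow shift_el i) (/ 4))) as [H1|H1];
    [left; apply Fcopy_out; now left|].
  destruct (Rle_dec (Fval (fpow shift_el i) (/ 2)) x) as [H2|H2];
    [left; apply Fcopy_out; now right|].
  right. apply Fcopy_out.
  destruct (Nat.lt_total i j) as [L|[L|L]]; [left|contradiction|right];
    apply fpow_shift_lt in L; lra.
Qed.

Lemma Fcopy_shift j g x :
  Fval (Fcopy j g) (Fval (fpow shift_el j) x) = Fval (fpow shift_el j) (Fval (fquarter g) x).
Proof. unfold Fcopy. now rewrite !fcompE, finvKl. Qed.

Lemma Fcopy_comp j a b c : (forall x, Fval c x = Fval a (Fval b x)) ->
  forall x, Fval (Fcopy j c) x = Fval (Fcopy j a) (Fval (Fcopy j b) x).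
Proof.
  intros H x. unfold Fcopy. rewrite !fcompE, finvKl, fquarter_comp, fquarterE.
  now rewrite H.
Qed.

Lemma Fcopy_inj j a b : (forall x, Fval (Fcopy j a) x = Fval (Fcopy j b) x) ->
  forall x, Fval a x = Fval b x.
Proof.
  intros H x. specialize (H (Fval (fpow shift_el j) ((x + 1) / 4))).
  rewrite !Fcopy_shift in H. apply Fval_inj in H. rewrite !fquarterE in H.
  replace (4 * ((x + 1) / 4) - 1) with x in H by field. lra.
Qed.

(** * Noncommutation in F and in the free product *)

Lemma F_noncommuting : exists a b : Fel, Fval a (Fval b (/ 2)) <> Fval b (Fval a (/ 2)).
Proof.
  (* As [b] fixes 1/2, the two products send 1/2 to 3/4 and to 7/8. *)
  destruct (F_two_point (/ 4) (/ 2) (/ 2) (3 / 4)) as [a [_ Ha]]; try lra;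
    [dyadic_frac|dyadic_frac|dyadic_frac|dyadic_frac|].
  destruct (F_two_point (/ 2) (3 / 4) (/ 2) (7 / 8)) as [b [Hb Hb']]; try lra;
    [dyadic_frac|dyadic_frac|dyadic_frac|dyadic_frac|].
  exists a, b. rewrite Hb, Ha, Hb'. lra.
Qed.

(* Affine model of F * Z: the generator of Z acts by [x |-> p + l (x - p)]. *)
Fixpoint eval (l p : R) (w : word) (x : R) : R :=
  match w with
  | [] => x
  | inl a :: w => Fval a (eval l p w x)
  | inr n :: w => p + powerRZ l n * (eval l p w x - p)
  end.

Lemma eval_app l p u v x : eval l p (u ++ v) x = eval l p u (eval l p v x).
Proof. induction u as [|[a|n] u IH]; simpl; now rewrite ?IH. Qed.

Lemma eval_wequiv l p u v : l <> 0 -> wequiv u v -> forall x, eval l p u x = eval l p v x.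
Proof.
  intros Hl. induction 1 as [u v H|u|u v _ IH|u v w _ IH1 _ IH2]; intros x; auto; [|congruence].
  destruct H as [u l1 r1 v H]. rewrite !eval_app. f_equal.
  generalize (eval l p v x) as y. intros y.
  destruct H as [a b c H|e H|m n|]; simpl; auto.
  - rewrite powerRZ_add by assumption. ring.
  - ring.
Qed.

Lemma wequiv_F (a b : Fel) : wequiv [inl a] [inl b] -> forall x, Fval a x = Fval b x.
Proof. intros H x. apply (eval_wequiv 1 0 _ _ R1_neq_R0 H x). Qed.

(** In a model where [t] sends a point [y0] moved by [b] to a point [x0] moved by [a], and a fixed
    point [y2] of [b] to [a x0], the element [t b t^-1] fixes [a x0]. If it commuted with [a], it
    would fix [x0], and [b] would fix [y0]. *)
Lemma free_product_noncommuting (a b : Fel) :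
  (exists x, Fval a x <> x) -> (exists x, Fval b x <> x) ->
  ~ wequiv [inl a; inr 1%Z; inl b; inr (-1)%Z] [inr 1%Z; inl b; inr (-1)%Z; inl a].
Proof.
  intros [x0 Hx] [y0 Hy] H.
  (* The point [y2] lies outside [0,1], so [b] fixes it, and so far out that the slope [l] has
     absolute value below 1. Thus the affine map has a fixed point [p]. *)
  set (x1 := Fval a x0) in *. set (y2 := Rabs y0 + Rabs (x1 - x0) + 2).
  pose proof (Rle_abs y0). pose proof (Rle_abs (x1 - x0)). pose proof (Rle_abs (- (x1 - x0))).
  rewrite Rabs_Ropp in H2.
  pose proof (Rabs_pos y0). pose proof (Rabs_pos (x1 - x0)).
  assert (Hy2 : Fval b y2 = y2) by (apply Fval_out; unfold inI, y2; lra).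
  assert (Hpos : 0 < y2 - y0) by (unfold y2; lra).
  set (l := (x1 - x0) / (y2 - y0)).
  assert (El : l * (y2 - y0) = x1 - x0) by (unfold l; field; lra).
  assert (Hl0 : l <> 0).
  { intros E. rewrite E in El. apply Hx. lra. }
  assert (Hl1 : 1 - l <> 0).
  { intros E. replace l with 1 in El by lra. unfold y2 in El. lra. }
  (* The model map sends [y0] to [x0] and [y2] to [x1]. *)
  set (p := (x0 - l * y0) / (1 - l)).
  assert (Ep : p + l * (y0 - p) = x0) by (unfold p; field; lra).
  assert (Ep2 : p + l * (y2 - p) = x1) by lra.
  assert (Einv : forall y, p + / l * (p + l * (y - p) - p) = y) by (intros; field; auto).
  assert (Eq := eval_wequiv l p _ _ Hl0 H x0). simpl in Eq.
  rewrite !Rmult_1_r in Eq. fold x1 in Eq.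
  rewrite <- Ep2, Einv, Hy2, Ep2 in Eq. unfold x1 in Eq at 1. apply Fval_inj in Eq.
  rewrite <- Ep, Einv in Eq. rewrite Ep in Eq.
  apply Hy. apply Rmult_eq_reg_l with l; auto. lra.
Qed.

(** * C^1 maps and intervals *)

(** Retraction onto [0,1]: composing with it turns maps controlled only on [0,1] into maps to which
    theorems about the real line apply. *)
Definition clamp (x : R) : R := Rmax 0 (Rmin x 1).

Lemma clamp_I x : inI (clamp x).
Proof. unfold clamp, inI, Rmax, Rmin. repeat destruct Rle_dec; lra. Qed.

Lemma clamp_id x : inI x -> clamp x = x.
Proof. unfold clamp, inI, Rmax, Rmin. intros H. repeat destruct Rle_dec; lra. Qed.

Lemma clamp_lipschitz x y : Rabs (clamp y - clamp x) <= Rabs (y - x).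
Proof. unfold clamp, Rmax, Rmin, Rabs. repeat destruct Rle_dec; repeat destruct Rcase_abs; lra. Qed.

Lemma clamp_continuous f : continuous_on_I f ->
  forall x, continuity_pt (fun y => f (clamp y)) x.
Proof.
  intros Hf x eps Heps.
  destruct (Hf (clamp x) (clamp_I x) eps Heps) as [d [Hd H]].
  exists d. split; [exact Hd|]. intros y [_ Hy]. simpl in *. unfold Rdist in *.
  apply H; [apply clamp_I|]. eapply Rle_lt_trans; [apply clamp_lipschitz|exact Hy].
Qed.

Lemma C1_continuous f f' : (forall x, inI x -> derive_within_I f x (f' x)) ->
  continuous_on_I f.
Proof.
  intros Hf x Hx eps Heps.
  destruct (Hf x Hx 1 Rlt_0_1) as [d [Hd H]].
  set (M := Rabs (f' x) + 1).
  assert (HM : 0 < M) by (unfold M; pose proof (Rabs_pos (f' x)); lra).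
  exists (Rmin d (eps / M)). split.
  { apply Rmin_pos; [exact Hd|]. now apply Rdiv_lt_0_compat. }
  intros y Hy Hyx.
  pose proof (Rmin_l d (eps / M)). pose proof (Rmin_r d (eps / M)).
  destruct (Req_dec y x) as [->|Hne]; [rewrite Rminus_diag, Rabs_R0; exact Heps|].
  specialize (H y Hy Hne ltac:(lra)).
  assert (Hq : Rabs ((f y - f x) / (y - x)) <= M).
  { replace ((f y - f x) / (y - x)) with ((f y - f x) / (y - x) - f' x + f' x) by ring.
    eapply Rle_trans; [apply Rabs_triang|]. unfold M. lra. }
  replace (f y - f x) with ((f y - f x) / (y - x) * (y - x)) by (field; lra).
  rewrite Rabs_mult. apply Rle_lt_trans with (M * Rabs (y - x)).
  - apply Rmult_le_compat_r; [apply Rabs_pos|exact Hq].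
  - apply Rlt_le_trans with (M * (eps / M)); [apply Rmult_lt_compat_l; lra|].
    right. field. lra.
Qed.

Lemma C1_mean_value f f' : (forall x, inI x -> derive_within_I f x (f' x)) ->
  forall x y, 0 <= x -> x < y -> y <= 1 ->
  exists z, x <= z <= y /\ f y - f x = f' z * (y - x).
Proof.
  intros Hf x y Hx Hxy Hy.
  destruct (Coquelicot.Derive.MVT_gen (fun t => f (clamp t)) x y (fun t => f' (clamp t)))
    as [z [Hz E]].
  - rewrite Rmin_left, Rmax_right by lra. intros t Ht.
    apply Coquelicot.Derive.is_derive_Reals. intros eps Heps.
    assert (Ht' : inI t) by (unfold inI; lra). rewrite (clamp_id t) by exact Ht'.
    destruct (Hf t Ht' eps Heps) as [d [Hd H]].
    assert (Hm : 0 < Rmin d (Rmin t (1 - t))) by (repeat apply Rmin_pos; lra).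
    exists (mkposreal _ Hm). simpl. intros h Hh0 Hh.
    pose proof (Rmin_l d (Rmin t (1 - t))). pose proof (Rmin_r d (Rmin t (1 - t))).
    pose proof (Rmin_l t (1 - t)). pose proof (Rmin_r t (1 - t)).
    assert (Hh' : Rabs h < t /\ Rabs h < 1 - t) by lra.
    destruct Hh' as [Ha Hb]. apply Rabs_def2 in Ha, Hb.
    assert (HI : inI (t + h)) by (unfold inI; lra).
    rewrite (clamp_id _ HI).
    specialize (H (t + h) HI). replace (t + h - t) with h in H by ring.
    apply H; lra.
  - intros t _. apply clamp_continuous. now apply (C1_continuous f f').
  - rewrite Rmin_left, Rmax_right in Hz by lra.
    exists z. split; [exact Hz|]. rewrite !clamp_id in E by (unfold inI; lra). exact E.
Qed.

(* On a short interval with fixed endpoints the derivative takes the value 1,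
   hence is everywhere larger than 1/2. *)
Lemma C1_short_interval_expansion f : C1_on_I f ->
  exists delta, 0 < delta /\ forall c d, 0 <= c -> c < d -> d <= 1 -> d - c < delta ->
    f c = c -> f d = d ->
    forall x y, c <= x -> x < y -> y <= d -> (y - x) / 2 < f y - f x.
Proof.
  intros [f' [Hf Hc]].
  assert (Hu : uniform_continuity (fun y => f' (clamp y)) (fun x => 0 <= x <= 1)).
  { apply Heine; [apply compact_P3|]. intros; now apply clamp_continuous. }
  destruct (Hu (mkposreal (/ 2) ltac:(lra))) as [[delta Hd] H]. simpl in H.
  exists delta. split; [exact Hd|]. intros c d Hc0 Hcd Hd1 Hsmall Ec Ed x y Hx Hxy Hy.
  destruct (C1_mean_value f f' Hf c d) as [z0 [Hz0 E0]]; try lra.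
  destruct (C1_mean_value f f' Hf x y) as [z [Hz E]]; try lra.
  assert (E1 : f' z0 = 1).
  { apply Rmult_eq_reg_r with (d - c); lra. }
  assert (Hn : Rabs (f' z - f' z0) < / 2).
  { specialize (H z z0 ltac:(lra) ltac:(lra)).
    rewrite !clamp_id in H by (unfold inI; lra). apply H. apply Rabs_def1; lra. }
  rewrite E1 in Hn. apply Rabs_def2 in Hn. rewrite E. unfold Rdiv. rewrite Rmult_comm.
  apply Rmult_lt_compat_r; lra.
Qed.

(** * Connectedness, closures and fibres *)

Lemma interval_connected c d : connected_R (fun x => c < x < d).
Proof.
  intros (U & V & HU & HV & Hcov & (u & Au & Uu) & (v & Av & Vv) & Hdis).
  assert (Hgen : forall U V : R -> Prop, open_R U -> open_R V ->
     (forall x, c < x < d -> U x \/ V x) -> (forall x, c < x < d -> ~ (U x /\ V x)) ->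
     forall u v, c < u < d -> U u -> c < v < d -> V v -> ~ u < v).
  { clear. intros U V HU HV Hcov Hdis u v Au Uu Av Vv Huv.
    (* The supremum [s] of the part of [U] in [u, v] can lie neither in [U] nor in [V], both being
       open. *)
    destruct (completeness (fun z => u <= z <= v /\ U z)) as [s [Hub Hlub]].
    { exists v. intros z [Hz _]. lra. }
    { exists u. split; [lra|exact Uu]. }
    assert (Hus : u <= s) by (apply Hub; split; [lra|exact Uu]).
    assert (Hsv : s <= v) by (apply Hlub; intros z [Hz _]; lra).
    assert (As : c < s < d) by lra.
    destruct (Hcov s As) as [Us|Vs].
    - assert (Hne : s <> v) by (intros ->; apply (Hdis v Av); auto).
      destruct (HU s Us) as [e [He H]].
      assert (Hm : 0 < Rmin (e / 2) (v - s)) by (apply Rmin_pos; lra).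
      pose proof (Rmin_l (e / 2) (v - s)). pose proof (Rmin_r (e / 2) (v - s)).
      assert (s + Rmin (e / 2) (v - s) <= s); [|lra].
      apply Hub. split; [lra|]. apply H. apply Rabs_def1; lra.
    - destruct (HV s Vs) as [e [He H]].
      assert (s <= s - e); [|lra]. apply Hlub. intros z [Hz Uz].
      apply Rnot_lt_le. intros Hlt. apply (Hdis z); [lra|]. split; [exact Uz|].
      apply H. assert (z <= s) by (apply Hub; auto). apply Rabs_def1; lra. }
  destruct (Rtotal_order u v) as [H|[H|H]].
  - exact (Hgen U V HU HV Hcov Hdis u v Au Uu Av Vv H).
  - subst. apply (Hdis v Av); auto.
  - apply (Hgen V U HV HU) with (u := v) (v := u); auto.
    + intros x Hx. destruct (Hcov x Hx); auto.
    + intros x Hx [H1 H2]. apply (Hdis x Hx); auto.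
Qed.

Lemma connected_avoids (K : R -> Prop) c : connected_R K -> ~ K c ->
  forall x y, K x -> K y -> x < c -> c < y -> False.
Proof.
  intros HK Hc x y Kx Ky Hx Hy. apply HK.
  exists (fun z => z < c), (fun z => c < z). repeat split.
  - intros z Hz. exists (c - z). split; [lra|]. intros t Ht. apply Rabs_def2 in Ht. lra.
  - intros z Hz. exists (z - c). split; [lra|]. intros t Ht. apply Rabs_def2 in Ht. lra.
  - intros z Kz. destruct (Rtotal_order z c) as [H|[H|H]]; auto. now subst.
  - now exists x.
  - now exists y.
  - intros z _. lra.
Qed.

Lemma closure_interval c d x : c < d -> (closure_R (fun y => c < y < d) x <-> c <= x <= d).
Proof.
  intros Hcd. split.
  - intros H. split; apply Rnot_lt_le; intros Hx.
    + destruct (H (c - x)) as [y [Hy Hy']]; [lra|]. apply Rabs_def2 in Hy'. lra.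
    + destruct (H (x - d)) as [y [Hy Hy']]; [lra|]. apply Rabs_def2 in Hy'. lra.
  - intros Hx eps Heps.
    destruct (Rle_dec x ((c + d) / 2)) as [H|H].
    + pose proof (Rmin_l (eps / 2) ((d - c) / 4)). pose proof (Rmin_r (eps / 2) ((d - c) / 4)).
      assert (0 < Rmin (eps / 2) ((d - c) / 4)) by (apply Rmin_pos; lra).
      exists (x + Rmin (eps / 2) ((d - c) / 4)). split; [lra|]. apply Rabs_def1; lra.
    + pose proof (Rmin_l (eps / 2) ((d - c) / 4)). pose proof (Rmin_r (eps / 2) ((d - c) / 4)).
      assert (0 < Rmin (eps / 2) ((d - c) / 4)) by (apply Rmin_pos; lra).
      exists (x - Rmin (eps / 2) ((d - c) / 4)). split; [lra|]. apply Rabs_def1; lra.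
Qed.

(** By continuity the fibre is closed, so its supremum belongs to it. *)
Lemma fibre_sup (h : R -> R) c d y :
  (forall x, c <= x <= d -> forall eps, 0 < eps -> exists delta, 0 < delta /\
     forall z, c <= z <= d -> Rabs (z - x) < delta -> Rabs (h z - h x) < eps) ->
  (exists x, c <= x <= d /\ h x = y) ->
  exists s, c <= s <= d /\ h s = y /\ forall w, c <= w <= d -> h w = y -> w <= s.
Proof.
  intros Hc [x0 [Hx0 E0]].
  destruct (completeness (fun z => c <= z <= d /\ h z = y)) as [s [Hub Hlub]].
  { exists d. intros z [Hz _]. lra. }
  { now exists x0. }
  assert (Hs : c <= s <= d).
  { split; [apply Rle_trans with x0; [lra|now apply Hub]|].
    apply Hlub. intros z [Hz _]. lra. }
  exists s. split; [exact Hs|split]; [|intros w Hw E; now apply Hub].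
  apply NNPP. intros Hne.
  assert (Heps : 0 < Rabs (h s - y)) by (apply Rabs_pos_lt; lra).
  destruct (Hc s Hs _ Heps) as [delta [Hd H]].
  assert (s <= s - delta); [|lra]. apply Hlub. intros z [Hz Ez].
  apply Rnot_lt_le. intros Hlt. assert (z <= s) by (apply Hub; auto).
  specialize (H z Hz ltac:(apply Rabs_def1; lra)).
  rewrite Ez, Rabs_minus_sym in H. lra.
Qed.

Lemma fibre_inf (h : R -> R) c d y :
  (forall x, c <= x <= d -> forall eps, 0 < eps -> exists delta, 0 < delta /\
     forall z, c <= z <= d -> Rabs (z - x) < delta -> Rabs (h z - h x) < eps) ->
  (exists x, c <= x <= d /\ h x = y) ->
  exists s, c <= s <= d /\ h s = y /\ forall w, c <= w <= d -> h w = y -> s <= w.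
Proof.
  intros Hc [x0 [Hx0 E0]].
  destruct (fibre_sup (fun x => h (- x)) (- d) (- c) y) as (s & Hs & Es & Hmax).
  - intros x Hx eps Heps. destruct (Hc (- x) ltac:(lra) eps Heps) as [delta [Hd H]].
    exists delta. split; [exact Hd|]. intros z Hz Hzx. apply H; [lra|].
    replace (- z - - x) with (- (z - x)) by ring. now rewrite Rabs_Ropp.
  - exists (- x0). rewrite Ropp_involutive. split; [lra|exact E0].
  - exists (- s). split; [lra|split; [exact Es|]]. intros w Hw Ew.
    assert (- w <= s); [|lra]. apply Hmax; [lra|]. now rewrite Ropp_involutive.
Qed.

Lemma wequiv_step u v : wstep u v -> wequiv u v.
Proof.
  intros H. apply rst_step. pose proof (wr_ctx [] u v [] H) as H'.
  simpl in H'. now rewrite !app_nil_r in H'.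
Qed.

(** * Faithful and unfaithful gaps *)

Section Action.

Variable Phi : word -> R -> R.
Hypothesis Phi_hom : hom_FZ Phi.

Lemma Phi_diff w : Diff1plus (Phi w).
Proof. apply Phi_hom. Qed.

Lemma Phi_app u v x : inI x -> Phi (u ++ v) x = Phi u (Phi v x).
Proof. apply Phi_hom. Qed.

Lemma Phi_nil x : inI x -> Phi [] x = x.
Proof. apply Phi_hom. Qed.

Lemma Phi_wequiv u v x : wequiv u v -> inI x -> Phi u x = Phi v x.
Proof. intros H. now apply Phi_hom. Qed.

Lemma Phi_I w x : inI x -> inI (Phi w x).
Proof. apply (Phi_diff w). Qed.

Lemma Phi_surj w x : inI x -> exists z, inI z /\ Phi w z = x.
Proof.
  intros Hx. destruct (Phi_diff w) as (_ & _ & (g & HgI & _ & _ & H) & _).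
  exists (g x). auto.
Qed.

Lemma Phi_inj w x y : inI x -> inI y -> Phi w x = Phi w y -> x = y.
Proof.
  intros Hx Hy E. destruct (Phi_diff w) as (_ & _ & (g & _ & _ & H & _) & _).
  rewrite <- (H x Hx), <- (H y Hy). now rewrite E.
Qed.

Lemma Phi_le w x y : inI x -> inI y -> x <= y -> Phi w x <= Phi w y.
Proof. apply (Phi_diff w). Qed.

Lemma Phi_lt w x y : inI x -> inI y -> x < y -> Phi w x < Phi w y.
Proof.
  intros Hx Hy Hxy. destruct (Phi_le w x y Hx Hy (Rlt_le _ _ Hxy)) as [H|H]; [exact H|].
  apply Phi_inj in H; auto. lra.
Qed.

Lemma Phi_lt_inv w x y : inI x -> inI y -> Phi w x < Phi w y -> x < y.
Proof.
  intros Hx Hy H. apply Rnot_le_lt. intros H'. apply (Phi_le w) in H'; auto. lra.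
Qed.

Lemma Phi_01 w : Phi w 0 = 0 /\ Phi w 1 = 1.
Proof.
  assert (I0 : inI 0) by (unfold inI; lra). assert (I1 : inI 1) by (unfold inI; lra).
  destruct (Phi_surj w 0 I0) as [z [Hz Ez]], (Phi_surj w 1 I1) as [t [Ht Et]].
  assert (Phi w 0 <= Phi w z) by (apply Phi_le; auto; apply Hz).
  assert (Phi w t <= Phi w 1) by (apply Phi_le; auto; apply Ht).
  pose proof (Phi_I w 0 I0). pose proof (Phi_I w 1 I1). unfold inI in *. lra.
Qed.

Lemma Phi_F a b c x : (forall y, Fval c y = Fval a (Fval b y)) -> inI x ->
  Phi [inl c] x = Phi [inl a] (Phi [inl b] x).
Proof.
  intros H Hx. rewrite <- Phi_app by exact Hx. apply Phi_wequiv; [|exact Hx].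
  apply rst_sym, wequiv_step. now constructor.
Qed.

Lemma Phi_F_relation a b c d x : (forall y, Fval a (Fval b y) = Fval c (Fval d y)) ->
  inI x -> Phi [inl a] (Phi [inl b] x) = Phi [inl c] (Phi [inl d] x).
Proof.
  intros H Hx.
  rewrite <- (Phi_F a b (fcomp a b)), <- (Phi_F c d (fcomp a b)); auto; intros y;
    rewrite fcompE; auto.
Qed.

Section Embedding.

Variable iota : Fel -> word.
Hypothesis iota_emb : inj_hom_F iota.

Notation act g := (Phi (iota g)).

Lemma act_comp a b c x : (forall y, Fval c y = Fval a (Fval b y)) -> inI x ->
  act c x = act a (act b x).
Proof.
  intros H Hx. rewrite <- Phi_app by exact Hx. apply Phi_wequiv; [|exact Hx].
  now apply iota_emb.
Qed.

Lemma act_fcomp a b x : inI x -> act (fcomp a b) x = act a (act b x).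
Proof. apply act_comp, fcompE. Qed.

(** From [e e = e] the action of [e] is idempotent, and it is injective. *)
Lemma act_id e x : (forall y, Fval e y = y) -> inI x -> act e x = x.
Proof.
  intros H Hx. apply (Phi_inj (iota e)); auto using Phi_I.
  symmetry. apply act_comp; [|exact Hx]. intros y. now rewrite !H.
Qed.

Lemma act_invK g x : inI x -> act g (act (finv g) x) = x.
Proof.
  intros Hx. rewrite <- act_fcomp by exact Hx.
  apply act_id; auto. intros y. now rewrite fcompE, finvK.
Qed.

Lemma act_invKl g x : inI x -> act (finv g) (act g x) = x.
Proof.
  intros Hx. rewrite <- act_fcomp by exact Hx.
  apply act_id; auto. intros y. now rewrite fcompE, finvKl.
Qed.

(** The hypothesis for [g^-1] gives the reverse inequality for [g]. *)
Lemma act_fixed_of_le x : inI x -> (forall g, x <= act g x) -> forall g, act g x = x.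
Proof.
  intros Hx H g. apply Rle_antisym; [|apply H].
  rewrite <- (act_invK g x Hx) at 2. apply Phi_le; auto using Phi_I.
Qed.

Lemma act_fixed_of_ge x : inI x -> (forall g, act g x <= x) -> forall g, act g x = x.
Proof.
  intros Hx H g. apply Rle_antisym; [apply H|].
  rewrite <- (act_invK g x Hx) at 1. apply Phi_le; auto using Phi_I.
Qed.

End Embedding.

(* The open intervals (c,d) which are components of the support. *)
Record gap (iota : Fel -> word) (c d : R) : Prop := {
  gap_lo : 0 <= c;
  gap_lt : c < d;
  gap_hi : d <= 1;
  gap_fix_l : forall g, Phi (iota g) c = c;
  gap_fix_r : forall g, Phi (iota g) d = d;
  gap_moved : forall x, c < x < d -> exists g, Phi (iota g) x <> x }.

Definition faithful_gap (iota : Fel -> word) (c d : R) : Prop :=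
  gap iota c d /\
  forall g, (exists x, Fval g x <> x) -> exists x, c < x < d /\ Phi (iota g) x <> x.

(** The endpoints are the nearest global fixed points on both sides of [x]. They are fixed because a
    supremum of fixed points can only be moved upwards, and an infimum only downwards; the right one
    is written [1 - m] so that suprema suffice. *)
Lemma gap_exists iota x g : inj_hom_F iota -> inI x -> Phi (iota g) x <> x ->
  exists c d, c < x < d /\ gap iota c d.
Proof.
  intros Hi Hx Hg.
  destruct (completeness (fun y => 0 <= y <= x /\ forall g, Phi (iota g) y = y))
    as [c [Hub Hlub]].
  { exists x. intros y [Hy _]. lra. }
  { exists 0. split; [unfold inI in Hx; lra|]. intros; apply Phi_01. }
  destruct (completeness (fun y => 0 <= y <= 1 - x /\
      forall g, Phi (iota g) (1 - y) = 1 - y)) as [m [Hub' Hlub']].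
  { exists 1. intros y [Hy _]. unfold inI in Hx; lra. }
  { exists 0. split; [unfold inI in Hx; lra|]. intros; rewrite Rminus_0_r; apply Phi_01. }
  assert (Hc0 : 0 <= c).
  { apply Hub. split; [unfold inI in Hx; lra|]. intros; apply Phi_01. }
  assert (Hm0 : 0 <= m).
  { apply Hub'. split; [unfold inI in Hx; lra|]. intros; rewrite Rminus_0_r; apply Phi_01. }
  assert (Hcx : c <= x) by (apply Hlub; intros y [Hy _]; lra).
  assert (Hmx : m <= 1 - x) by (apply Hlub'; intros y [Hy _]; lra).
  assert (HIc : inI c) by (unfold inI in *; lra).
  assert (HIm : inI (1 - m)) by (unfold inI in *; lra).
  assert (Fc : forall g, Phi (iota g) c = c).
  { apply act_fixed_of_le; auto. intros k. apply Hlub. intros y [Hy Ey].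
    rewrite <- (Ey k). apply Phi_le; [unfold inI in *; lra|exact HIc|].
    apply Hub; split; auto. }
  assert (Fm : forall g, Phi (iota g) (1 - m) = 1 - m).
  { apply act_fixed_of_ge; auto. intros k.
    assert (m <= 1 - Phi (iota k) (1 - m)); [|lra]. apply Hlub'. intros y [Hy Ey].
    assert (Phi (iota k) (1 - m) <= 1 - y); [|lra].
    rewrite <- (Ey k). apply Phi_le; [exact HIm|unfold inI in *; lra|].
    assert (y <= m) by (apply Hub'; split; auto). lra. }
  assert (c <> x) by (intros ->; apply Hg, Fc).
  assert (1 - m <> x) by (intros <-; apply Hg, Fm).
  exists c, (1 - m). split; [lra|]. split; auto; try lra.
  intros y Hy. apply not_all_ex_not. intros Fy.
  destruct (Rle_dec y x) as [H1|H1].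
  - assert (y <= c); [|lra]. apply Hub. split; [lra|auto].
  - assert (1 - y <= m); [|lra]. apply Hub'. split; [lra|].
    intros k. replace (1 - (1 - y)) with y by ring. auto.
Qed.

Lemma gap_inI iota c d x : gap iota c d -> c <= x <= d -> inI x.
Proof. intros [H1 H2 H3 _ _ _] Hx. unfold inI. lra. Qed.

Lemma gap_no_fixed iota c d x : gap iota c d -> (forall g, Phi (iota g) x = x) ->
  ~ c < x < d.
Proof. intros G F Hx. destruct (gap_moved _ _ _ G x Hx) as [g Hg]. auto. Qed.

Lemma gap_unique iota c d c' d' z : gap iota c d -> gap iota c' d' ->
  c < z < d -> c' < z < d' -> c = c' /\ d = d'.
Proof.
  intros G G' Hz Hz'.
  pose proof (gap_no_fixed _ _ _ _ G (gap_fix_l _ _ _ G')).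
  pose proof (gap_no_fixed _ _ _ _ G (gap_fix_r _ _ _ G')).
  pose proof (gap_no_fixed _ _ _ _ G' (gap_fix_l _ _ _ G)).
  pose proof (gap_no_fixed _ _ _ _ G' (gap_fix_r _ _ _ G)).
  lra.
Qed.

Lemma gap_interval_invariant w c d x : inI c -> inI d -> Phi w c = c -> Phi w d = d ->
  c < x < d -> c < Phi w x < d.
Proof.
  intros Hc Hd Ec Ed Hx. assert (Hx' : inI x) by (unfold inI in *; lra).
  rewrite <- Ec, <- Ed. split; apply Phi_lt; auto; lra.
Qed.

(** The endpoints are outside the support, so a connected subset of it cannot leave the gap. This
    makes the dichotomy applicable to gaps. *)
Lemma gap_component iota c d : gap iota c d ->
  component (supp_action Phi iota) (fun x => c < x < d).
Proof.
  intros G. pose proof (gap_lt _ _ _ G) as Hcd.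
  split; [exists ((c + d) / 2); lra|]. split; [|split].
  - intros x Hx. split; [apply (gap_inI _ _ _ _ G); lra|now apply (gap_moved _ _ _ G)].
  - apply interval_connected.
  - intros K HK HJ HS x Kx.
    assert (Km : K ((c + d) / 2)) by (apply HJ; lra).
    assert (Kc : ~ K c) by (intros H; destruct (HS c H) as [_ [g Hg]]; apply Hg, G).
    assert (Kd : ~ K d) by (intros H; destruct (HS d H) as [_ [g Hg]]; apply Hg, G).
    split; apply Rnot_le_lt; intros H.
    + destruct H as [H|H]; [|now subst].
      apply (connected_avoids K c HK Kc x ((c + d) / 2)); auto; lra.
    + destruct H as [H|H]; [|now subst].
      apply (connected_avoids K d HK Kd ((c + d) / 2) x); auto; lra.
Qed.

(** Used both for conjugate copies of F and, with [iota1 = iota2], for maps commuting with one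
    copy. *)
Lemma faithful_gap_transport iota1 iota2 w c d :
  (forall g x, inI x -> Phi w (Phi (iota1 g) x) = Phi (iota2 g) (Phi w x)) ->
  faithful_gap iota1 c d -> faithful_gap iota2 (Phi w c) (Phi w d).
Proof.
  intros Hw [G Hf]. pose proof (gap_lt _ _ _ G) as Hcd.
  assert (Hc : inI c) by (apply (gap_inI _ _ _ _ G); lra).
  assert (Hd : inI d) by (apply (gap_inI _ _ _ _ G); lra).
  assert (Hmoved : forall g x, inI x -> Phi (iota1 g) x <> x ->
            Phi (iota2 g) (Phi w x) <> Phi w x).
  { intros g x Hx Hg E. apply Hg. rewrite <- Hw in E by exact Hx.
    apply Phi_inj in E; auto using Phi_I. }
  split; [split|].
  - apply (Phi_I w c Hc).
  - now apply Phi_lt.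
  - apply (Phi_I w d Hd).
  - intros g. rewrite <- Hw by exact Hc. now rewrite (gap_fix_l _ _ _ G).
  - intros g. rewrite <- Hw by exact Hd. now rewrite (gap_fix_r _ _ _ G).
  - intros x Hx. assert (HIx : inI x).
    { pose proof (Phi_I w c Hc). pose proof (Phi_I w d Hd). unfold inI in *; lra. }
    destruct (Phi_surj w x HIx) as [z [Hz <-]].
    destruct (gap_moved _ _ _ G z) as [g Hg].
    { split; apply (Phi_lt_inv w); auto; lra. }
    exists g. auto.
  - intros g Hg. destruct (Hf g Hg) as [x [Hx Hgx]].
    assert (HIx : inI x) by (apply (gap_inI _ _ _ _ G); lra).
    exists (Phi w x). split; [split; apply Phi_lt; auto; lra|auto].
Qed.

(* An unfaithful gap is acted on through a quotient of F by a nontrivial normal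
   subgroup, hence through an abelian group. *)
Lemma unfaithful_gap_commute iota c d : inj_hom_F iota -> gap iota c d ->
  ~ faithful_gap iota c d ->
  forall a b x, c < x < d ->
    Phi (iota (fquarter a)) (Phi (iota (fquarter b)) x) =
    Phi (iota (fquarter b)) (Phi (iota (fquarter a)) x).
Proof.
  intros Hi G Hn.
  assert (Hg : exists g, (exists x, Fval g x <> x) /\
                 forall x, c < x < d -> Phi (iota g) x = x).
  { apply NNPP. intros H. apply Hn. split; [exact G|]. intros g Hg.
    apply NNPP. intros H'. apply H. exists g. split; [exact Hg|]. intros x Hx.
    apply NNPP. intros H''. apply H'. now exists x. }
  destruct Hg as [g [Hg Hgx]].
  assert (Hinv : forall k x, c < x < d -> c < Phi (iota k) x < d).
  { intros k x. pose proof (gap_lt _ _ _ G).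
    apply gap_interval_invariant; try apply G; apply (gap_inI _ _ _ _ G); lra. }
  assert (HI : forall x, c < x < d -> inI x) by (intros x Hx; apply (gap_inI _ _ _ _ G); lra).
  destruct (F_conj_commutes g Hg) as [k Hk]. simpl in Hk.
  set (g' := fcomp (finv k) (fcomp g k)) in *.
  assert (Hg' : forall x, c < x < d -> Phi (iota g') x = x).
  { intros x Hx. unfold g'.
    rewrite !act_fcomp by auto using Phi_I.
    rewrite (Hgx (Phi (iota k) x)) by auto. apply act_invKl; auto. }
  intros a b x Hx. specialize (Hk a b).
  set (e := fcomp g' (fcomp (fquarter a) (finv g'))) in *.
  (* Both [g] and its conjugate [g'] act trivially on the gap, so [e] acts as [fquarter a] there,
     while [e] commutes with [fquarter b] in F. *)
  assert (He : forall x, c < x < d -> Phi (iota e) x = Phi (iota (fquarter a)) x).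
  { intros y Hy. unfold e.
    rewrite !(act_fcomp iota Hi) by auto using Phi_I.
    rewrite Hg' by auto. f_equal. rewrite <- (Hg' y Hy) at 1. apply act_invKl; auto. }
  rewrite <- !He by auto.
  rewrite <- (act_fcomp iota Hi e (fquarter b)) by auto.
  rewrite <- (act_comp iota Hi (fquarter b) e (fcomp e (fquarter b))); auto.
  intros y. now rewrite fcompE.
Qed.

(** * Consequences of the dichotomy for faithful gaps *)

Hypothesis dichotomy : forall iota : Fel -> word, inj_hom_F iota ->
  forall J : R -> Prop, component (supp_action Phi iota) J ->
    nonfaithful_on Phi iota J \/ semiconj_standard Phi iota J.

(** This is the body of [semiconj_standard] with the closure of the gap written as [c, d]. *)
Definition semiconj_on (iota : Fel -> word) (c d : R) (h : R -> R) : Prop :=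
  (forall x, c <= x <= d -> inI (h x)) /\
  (forall y, inI y -> exists x, c <= x <= d /\ h x = y) /\
  (forall x, c <= x <= d -> forall eps, 0 < eps -> exists delta, 0 < delta /\
     forall z, c <= z <= d -> Rabs (z - x) < delta -> Rabs (h z - h x) < eps) /\
  ((forall x y, c <= x <= d -> c <= y <= d -> x <= y -> h x <= h y) \/
   (forall x y, c <= x <= d -> c <= y <= d -> x <= y -> h y <= h x)) /\
  (forall g x, c <= x <= d -> h (Phi (iota g) x) = Fval g (h x)).

Lemma faithful_gap_semiconj iota c d : inj_hom_F iota -> faithful_gap iota c d ->
  exists h, semiconj_on iota c d h.
Proof.
  intros Hi [G Hf].
  destruct (dichotomy iota Hi _ (gap_component _ _ _ G)) as [(g & Hg & E)|(h & H)].
  - destruct (Hf g Hg) as [x [Hx Hgx]]. now destruct (Hgx (E x Hx)).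
  - exists h. simpl in H.
    assert (HK := fun x => closure_interval c d x (gap_lt _ _ _ G)).
    destruct H as (H1 & H2 & H3 & H4 & H5). split; [|split; [|split; [|split]]].
    + intros x Hx. now apply H1, HK.
    + intros y Hy. destruct (H2 y Hy) as [x [Hx E]]. exists x. split; [now apply HK|exact E].
    + intros x Hx eps Heps. destruct (H3 x (proj2 (HK x) Hx) eps Heps) as [delta [Hd H]].
      exists delta. split; [exact Hd|]. intros z Hz. apply H. now apply HK.
    + destruct H4 as [H4|H4]; [left|right]; intros x y Hx Hy; apply H4; now apply HK.
    + intros g x Hx. apply H5. now apply HK.
Qed.

(* Two elements of F map [1/4, 3/4] onto disjoint subintervals of itself. Lifting
   to a faithful gap, one of them contracts some interval at least by half, which
   is impossible in short gaps. *)
Lemma faithful_gap_length iota : inj_hom_F iota ->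
  exists delta, 0 < delta /\ forall c d, faithful_gap iota c d -> delta <= d - c.
Proof.
  intros Hi.
  destruct (F_two_point (/ 4) (3 / 4) (5 / 16) (7 / 16)) as (f & F1 & F2);
    try dyadic_frac; try lra.
  destruct (F_two_point (/ 4) (3 / 4) (9 / 16) (11 / 16)) as (g & G1 & G2);
    try dyadic_frac; try lra.
  destruct (C1_short_interval_expansion (Phi (iota f))) as [d1 [Hd1 H1]]; [apply Phi_diff|].
  destruct (C1_short_interval_expansion (Phi (iota g))) as [d2 [Hd2 H2]]; [apply Phi_diff|].
  exists (Rmin d1 d2). split; [now apply Rmin_pos|].
  intros c d Hfg. apply Rnot_lt_le. intros Hlt.
  pose proof (Rmin_l d1 d2). pose proof (Rmin_r d1 d2).
  destruct (faithful_gap_semiconj iota c d Hi Hfg) as (h & _ & Hsurj & _ & Hmono & Heq).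
  destruct Hfg as [G _].
  destruct (Hsurj (/ 4)) as [x1 [Hx1 E1]]; [unfold inI; lra|].
  destruct (Hsurj (3 / 4)) as [x2 [Hx2 E2]]; [unfold inI; lra|].
  assert (Hinv : forall k x, c <= x <= d -> c <= Phi (iota k) x <= d).
  { intros k x Hx. rewrite <- (gap_fix_l _ _ _ G k) at 1. rewrite <- (gap_fix_r _ _ _ G k).
    pose proof (gap_lt _ _ _ G).
    split; apply Phi_le; try lra; apply (gap_inI _ _ _ _ G); lra. }
  pose proof (Hinv f x1 Hx1). pose proof (Hinv f x2 Hx2).
  pose proof (Hinv g x1 Hx1). pose proof (Hinv g x2 Hx2).
  assert (Ef1 := Heq f x1 Hx1). assert (Ef2 := Heq f x2 Hx2).
  assert (Eg1 := Heq g x1 Hx1). assert (Eg2 := Heq g x2 Hx2).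
  rewrite E1, F1 in Ef1. rewrite E2, F2 in Ef2. rewrite E1, G1 in Eg1. rewrite E2, G2 in Eg2.
  pose proof (gap_lo _ _ _ G). pose proof (gap_lt _ _ _ G). pose proof (gap_hi _ _ _ G).
  assert (Hexp1 := H1 c d ltac:(lra) ltac:(lra) ltac:(lra) ltac:(lra)
    (gap_fix_l _ _ _ G f) (gap_fix_r _ _ _ G f)).
  assert (Hexp2 := H2 c d ltac:(lra) ltac:(lra) ltac:(lra) ltac:(lra)
    (gap_fix_l _ _ _ G g) (gap_fix_r _ _ _ G g)).
  (* For increasing [h] the order is x1 < f x1, f x2 < g x1, g x2 < x2. So the two images of
     [x1, x2] have total length below [x2 - x1], but each is longer than half of it. A decreasing
     [h] reverses the order. *)
  destruct Hmono as [Hm|Hm].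
  - assert (Hlt' : forall x y, c <= x <= d -> c <= y <= d -> h x < h y -> x < y).
    { intros x y Hx Hy Hh. apply Rnot_le_lt. intros H'. apply Hm in H'; auto. lra. }
    assert (x1 < Phi (iota f) x1) by (apply Hlt'; auto; lra).
    assert (Phi (iota f) x2 < Phi (iota g) x1) by (apply Hlt'; auto; lra).
    assert (Phi (iota g) x2 < x2) by (apply Hlt'; auto; lra).
    assert (x1 < x2) by (apply Hlt'; auto; lra).
    specialize (Hexp1 x1 x2). specialize (Hexp2 x1 x2). lra.
  - assert (Hlt' : forall x y, c <= x <= d -> c <= y <= d -> h x < h y -> y < x).
    { intros x y Hx Hy Hh. apply Rnot_le_lt. intros H'. apply Hm in H'; auto. lra. }
    assert (Phi (iota f) x1 < x1) by (apply Hlt'; auto; lra).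
    assert (Phi (iota g) x1 < Phi (iota f) x2) by (apply Hlt'; auto; lra).
    assert (x2 < Phi (iota g) x2) by (apply Hlt'; auto; lra).
    assert (x2 < x1) by (apply Hlt'; auto; lra).
    specialize (Hexp1 x2 x1). specialize (Hexp2 x2 x1). lra.
Qed.

(* A diffeomorphism commuting with the action permutes the faithful gaps; moving
   one of them would produce infinitely many, of length bounded below. *)
Lemma commuting_fixes_faithful_gap iota w c d : inj_hom_F iota ->
  (forall g x, inI x -> Phi w (Phi (iota g) x) = Phi (iota g) (Phi w x)) ->
  faithful_gap iota c d -> Phi w c = c /\ Phi w d = d.
Proof.
  intros Hi Hw H.
  destruct (faithful_gap_length iota Hi) as [delta [Hd Hlen]].
  (* A gap that is moved is disjoint from its image, so each application of [w] travels at least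
     [delta], always in the same direction. *)
  assert (Hit : forall k c d, faithful_gap iota c d ->
    (Phi w c < c -> exists c' d', faithful_gap iota c' d' /\ d' <= d - INR k * delta) /\
    (c < Phi w c -> exists c' d', faithful_gap iota c' d' /\ c + INR k * delta <= c')).
  { clear c d H. induction k as [|k IH]; intros c d H.
    - split; intros _; exists c, d; split; auto; simpl; lra.
    - pose proof (faithful_gap_transport iota iota w c d Hw H) as H'.
      destruct (IH _ _ H') as [IH1 IH2]. rewrite S_INR.
      pose proof (Hlen _ _ H). pose proof (Hlen _ _ H').
      assert (G := proj1 H). assert (G' := proj1 H').
      pose proof (gap_no_fixed _ _ _ _ G (gap_fix_l _ _ _ G')).
      pose proof (gap_no_fixed _ _ _ _ G (gap_fix_r _ _ _ G')).
      pose proof (gap_no_fixed _ _ _ _ G' (gap_fix_l _ _ _ G)).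
      assert (inI c) by (apply (gap_inI _ _ _ _ G); lra).
      assert (inI (Phi w c)) by auto using Phi_I.
      split; intros Hlt.
      + destruct IH1 as (c' & d' & Hg & Hle); [now apply Phi_lt|].
        exists c', d'. split; [exact Hg|]. lra.
      + destruct IH2 as (c' & d' & Hg & Hle); [now apply Phi_lt|].
        exists c', d'. split; [exact Hg|]. lra. }
  assert (Hbig : exists k, 1 < INR k * delta).
  { destruct (INR_unbounded (/ delta)) as [k Hk]. exists k.
    apply Rmult_lt_reg_r with (/ delta); [now apply Rinv_0_lt_compat|].
    rewrite Rmult_assoc, Rinv_r by lra. lra. }
  destruct Hbig as [k Hk]. destruct (Hit k c d H) as [H1 H2].
  assert (G := proj1 H). pose proof (gap_lo _ _ _ G). pose proof (gap_hi _ _ _ G).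
  assert (Ec : Phi w c = c).
  { destruct (Rtotal_order (Phi w c) c) as [Hc|[Hc|Hc]]; [|exact Hc|].
    - destruct (H1 Hc) as (c' & d' & [G' _] & Hle).
      pose proof (gap_lo _ _ _ G'). pose proof (gap_lt _ _ _ G'). lra.
    - destruct (H2 Hc) as (c' & d' & [G' _] & Hle).
      pose proof (gap_hi _ _ _ G'). pose proof (gap_lt _ _ _ G'). lra. }
  split; [exact Ec|].
  (* Two gaps with the same left endpoint coincide. *)
  destruct (faithful_gap_transport iota iota w c d Hw H) as [G' _]. rewrite Ec in G'.
  pose proof (gap_no_fixed _ _ _ _ G (gap_fix_r _ _ _ G')).
  pose proof (gap_no_fixed _ _ _ _ G' (gap_fix_r _ _ _ G)).
  pose proof (gap_lt _ _ _ G). pose proof (gap_lt _ _ _ G'). lra.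
Qed.

(** An element fixing [y] preserves the fibre over [y], as does its inverse, hence fixes the top and
    the bottom of this fibre. *)
Lemma fibre_extremum_fixed iota c d h y s g : inj_hom_F iota -> gap iota c d ->
  semiconj_on iota c d h -> Fval g y = y -> c <= s <= d -> h s = y ->
  (forall w, c <= w <= d -> h w = y -> w <= s) \/
  (forall w, c <= w <= d -> h w = y -> s <= w) ->
  Phi (iota g) s = s.
Proof.
  intros Hi G (_ & _ & _ & _ & Heq) Hg Hs Es Hext.
  assert (HI : inI s) by (now apply (gap_inI _ _ _ _ G)).
  assert (Hinv : forall k, c <= Phi (iota k) s <= d).
  { intros k. rewrite <- (gap_fix_l _ _ _ G k) at 1. rewrite <- (gap_fix_r _ _ _ G k).
    pose proof (gap_lt _ _ _ G).
    split; apply Phi_le; try lra; apply (gap_inI _ _ _ _ G); lra. }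
  assert (E1 : h (Phi (iota g) s) = y) by (now rewrite Heq, Es).
  assert (E2 : h (Phi (iota (finv g)) s) = y).
  { rewrite Heq, Es by exact Hs. rewrite <- Hg at 1. apply finvKl. }
  assert (E3 := act_invK iota Hi g s HI).
  assert (HI' := Phi_I (iota (finv g)) s HI).
  destruct Hext as [H|H]; apply H in E1, E2; auto;
    apply (Phi_le (iota g)) in E2; auto; rewrite E3 in E2; lra.
Qed.

(** Over a point fixed by all of F, the top and bottom of the fibre are global fixed points, hence
    the endpoints of the gap. Then [h] is constant by monotonicity and not surjective. *)
Lemma semiconj_interior iota c d h : inj_hom_F iota -> gap iota c d ->
  semiconj_on iota c d h ->
  forall x y, c < x < d -> h x = y -> ~ (forall g, Fval g y = y).
Proof.
  intros Hi G HS x y Hx Ex Hy.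
  assert (HS' := HS). destruct HS' as (_ & Hsurj & Hc & Hm & _).
  assert (Hex : exists x, c <= x <= d /\ h x = y) by (exists x; split; [lra|exact Ex]).
  destruct (fibre_sup h c d y Hc Hex) as (s & Hs & Es & Hmax).
  destruct (fibre_inf h c d y Hc Hex) as (t & Ht & Et & Hmin).
  assert (Hs' := gap_no_fixed _ _ _ s G (fun g => fibre_extremum_fixed _ _ _ _ _ _ g Hi G HS
    (Hy g) Hs Es (or_introl Hmax))).
  assert (Ht' := gap_no_fixed _ _ _ t G (fun g => fibre_extremum_fixed _ _ _ _ _ _ g Hi G HS
    (Hy g) Ht Et (or_intror Hmin))).
  assert (x <= s) by (apply Hmax; [lra|exact Ex]).
  assert (t <= x) by (apply Hmin; [lra|exact Ex]).
  assert (s = d) by lra. assert (t = c) by lra. subst s t.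
  assert (Hconst : forall z, c <= z <= d -> h z = y).
  { intros z Hz. pose proof (gap_lt _ _ _ G).
    destruct Hm as [Hm|Hm].
    - assert (h c <= h z) by (apply Hm; lra). assert (h z <= h d) by (apply Hm; lra). lra.
    - assert (h z <= h c) by (apply Hm; lra). assert (h d <= h z) by (apply Hm; lra). lra. }
  destruct (Hsurj 0) as [z0 [Hz0 E0]]; [unfold inI; lra|].
  destruct (Hsurj 1) as [z1 [Hz1 E1]]; [unfold inI; lra|].
  rewrite Hconst in E0, E1 by auto. lra.
Qed.

(** Otherwise some element fixes 1/2 and carries a dyadic point below [y] to one above [y], and so
    moves [y]. *)
Lemma F_stabilizer_half y : 0 < y < 1 ->
  (forall g, Fval g (/ 2) = / 2 -> Fval g y = y) -> y = / 2.
Proof.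
  intros Hy H. destruct (Rtotal_order y (/ 2)) as [L|[E|L]]; [|exact E|]; exfalso.
  - destruct (dyadic_between 0 y) as [c [Dc Hc]]; [lra|].
    destruct (dyadic_between y (/ 2) L) as [d [Dd Hd]].
    destruct (F_two_point c (/ 2) d (/ 2)) as [g [G1 G2]]; auto; try dyadic_frac; try lra.
    specialize (H g G2). pose proof (Fval_lt g c y). lra.
  - destruct (dyadic_between (/ 2) y L) as [c [Dc Hc]].
    destruct (dyadic_between y 1) as [d [Dd Hd]]; [lra|].
    destruct (F_two_point (/ 2) c (/ 2) d) as [g [G1 G2]]; auto; try dyadic_frac; try lra.
    specialize (H g G1). pose proof (Fval_lt g c y). lra.
Qed.

(* The top of the fibre over 1/2 is determined by the stabilizer of 1/2 in F,
   hence is preserved by everything that commutes with F. *)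
Lemma commuting_fixed_point iota c d : inj_hom_F iota -> faithful_gap iota c d ->
  exists s, c < s < d /\ forall w,
    (forall g x, inI x -> Phi w (Phi (iota g) x) = Phi (iota g) (Phi w x)) ->
    Phi w s = s.
Proof.
  intros Hi Hf. destruct (faithful_gap_semiconj iota c d Hi Hf) as [h HS].
  assert (G := proj1 Hf).
  assert (HS' := HS). destruct HS' as (HhI & Hsurj & Hc & _ & Heq).
  destruct (fibre_sup h c d (/ 2) Hc) as (s & Hs & Es & Hmax).
  { apply Hsurj. unfold inI; lra. }
  assert (Hfix : forall g, Fval g (/ 2) = / 2 -> Phi (iota g) s = s).
  { intros g Hg. apply (fibre_extremum_fixed iota c d h (/ 2)); auto. }
  assert (Hhalf : ~ forall g, Phi (iota g) s = s).
  { intros Hall. destruct (F_two_point (/ 4) (/ 2) (/ 4) (3 / 4)) as [g [_ Hg]];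
      try dyadic_frac; try lra.
    pose proof (Heq g s Hs) as E. rewrite Hall, Es, Hg in E. lra. }
  assert (Hs' : c < s < d).
  { assert (s <> c) by (intros ->; apply Hhalf, G).
    assert (s <> d) by (intros ->; apply Hhalf, G). lra. }
  exists s. split; [exact Hs'|]. intros w Hw.
  assert (HI : inI s) by (apply (gap_inI _ _ _ _ G); lra).
  (* A characterization of [s] by the action alone: the largest point of the gap fixed by the
     stabilizer of [s]. Elements fixing 1/2 fix [s], hence [z] and [h z], so [h z] is 1/2. *)
  assert (Htop : forall z, c < z < d -> (forall g, Phi (iota g) s = s -> Phi (iota g) z = z) ->
            z <= s).
  { intros z Hz Hz'. apply Hmax; [lra|]. apply F_stabilizer_half.
    - assert (HIz : inI (h z)) by (apply HhI; lra).
      assert (h z <> 0).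
      { intros E. apply (semiconj_interior iota c d h Hi G HS z 0 Hz E).
        intros g; apply Fval_01. }
      assert (h z <> 1).
      { intros E. apply (semiconj_interior iota c d h Hi G HS z 1 Hz E).
        intros g; apply Fval_01. }
      unfold inI in HIz. lra.
    - intros g Hg. rewrite <- Heq by lra. f_equal. auto. }
  destruct (commuting_fixes_faithful_gap iota w c d Hi Hw Hf) as [Ec Ed].
  pose proof (gap_lt _ _ _ G) as Hcd.
  assert (HIc : inI c) by (apply (gap_inI _ _ _ _ G); lra).
  assert (HId : inI d) by (apply (gap_inI _ _ _ _ G); lra).
  apply Rle_antisym.
  - apply Htop; [now apply gap_interval_invariant|].
    intros g Hg. rewrite <- Hw by exact HI. now rewrite Hg.
  (* The same argument for the preimage of [s] gives the other inequality. *)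
  - destruct (Phi_surj w s HI) as [z [HIz Ez]]. rewrite <- Ez at 1.
    apply Phi_le; auto. apply Htop.
    + split; apply (Phi_lt_inv w); auto; lra.
    + intros g Hg. apply (Phi_inj w); auto using Phi_I. rewrite Hw by exact HIz.
      now rewrite Ez.
Qed.

(** Each action fixes the endpoints of the faithful gaps of the other, so overlapping gaps coincide.
    The common gap then contains a point fixed by the second action. *)
Lemma commuting_faithful_gaps_disjoint iota1 iota2 c d c' d' z :
  inj_hom_F iota1 -> inj_hom_F iota2 ->
  (forall g k x, inI x -> Phi (iota1 g) (Phi (iota2 k) x) = Phi (iota2 k) (Phi (iota1 g) x)) ->
  faithful_gap iota1 c d -> faithful_gap iota2 c' d' -> c < z < d -> c' < z < d' -> False.
Proof.
  intros Hi1 Hi2 Hcomm Hf1 Hf2 Hz Hz'.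
  assert (G1 := proj1 Hf1). assert (G2 := proj1 Hf2).
  assert (Fix1 : forall k, Phi (iota2 k) c = c /\ Phi (iota2 k) d = d).
  { intros k. apply (commuting_fixes_faithful_gap iota1); auto.
    intros g x Hx. symmetry. auto. }
  assert (Fix2 : forall k, Phi (iota1 k) c' = c' /\ Phi (iota1 k) d' = d').
  { intros k. apply (commuting_fixes_faithful_gap iota2); auto. }
  pose proof (gap_no_fixed _ _ _ c G2 (fun k => proj1 (Fix1 k))).
  pose proof (gap_no_fixed _ _ _ d G2 (fun k => proj2 (Fix1 k))).
  pose proof (gap_no_fixed _ _ _ c' G1 (fun k => proj1 (Fix2 k))).
  pose proof (gap_no_fixed _ _ _ d' G1 (fun k => proj2 (Fix2 k))).
  assert (c = c') by lra. assert (d = d') by lra. subst c' d'.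
  destruct (commuting_fixed_point iota1 c d Hi1 Hf1) as [s [Hs Hfix]].
  apply (gap_no_fixed _ _ _ s G2); [|exact Hs].
  intros k. apply Hfix. intros g x Hx. symmetry. auto.
Qed.

(** * Commuting copies of F *)

Definition copy_word (j : nat) (g : Fel) : word := [inl (Fcopy j g)].

Lemma copy_word_emb j : inj_hom_F (copy_word j).
Proof.
  split.
  - intros a b c H. apply rst_sym, wequiv_step. constructor. now apply Fcopy_comp.
  - intros a b H. apply (Fcopy_inj j). now apply wequiv_F.
Qed.

Lemma copy_word_commute i j a b x : i <> j -> inI x ->
  Phi (copy_word i a) (Phi (copy_word j b) x) = Phi (copy_word j b) (Phi (copy_word i a) x).
Proof. intros Hij. apply Phi_F_relation. now apply Fcopy_commute. Qed.

(** This is the set [U_j] of the overview. *)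
Definition copy_supp (j : nat) (x : R) : Prop :=
  exists c d, faithful_gap (copy_word j) c d /\ c < x < d.

Lemma copy_supp_disjoint i j x : copy_supp i x -> copy_supp j x -> i = j.
Proof.
  intros (c & d & Hf & Hx) (c' & d' & Hf' & Hx'). apply NNPP. intros Hij.
  apply (commuting_faithful_gaps_disjoint (copy_word i) (copy_word j) c d c' d' x);
    auto using copy_word_emb.
  intros; now apply copy_word_commute.
Qed.

Lemma copy_supp_I j x : copy_supp j x -> inI x.
Proof. intros (c & d & [G _] & Hx). apply (gap_inI _ _ _ _ G). lra. Qed.

(* A commutator of elements supported in [1/4, 1/2] is trivial on unfaithful gaps. *)
Lemma commutator_supp : exists a : Fel, (forall j, exists x, Fval (Fcopy j a) x <> x) /\
  forall j x, inI x -> Phi (copy_word j a) x <> x -> copy_supp j x.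
Proof.
  destruct F_noncommuting as (b1 & b2 & Hb).
  set (u := fcomp (fquarter b2) (fquarter b1)).
  set (a := fcomp (fcomp (fquarter b1) (fquarter b2)) (finv u)).
  assert (Hau : forall x, Fval a (Fval u x) = Fval (fquarter b1) (Fval (fquarter b2) x)).
  { intros x. unfold a. now rewrite !fcompE, finvKl. }
  exists a. split.
  - intros j. apply not_all_ex_not. intros Hj. apply Hb.
    assert (Ha : forall x, Fval a x = x).
    { intros x. rewrite <- (fidE x) at 2. apply (Fcopy_inj j). intros y.
      rewrite Hj. unfold Fcopy. rewrite !fcompE, fquarterE, fidE.
      set (z := Fval (finv _) y).
      replace (/ 4 * (4 * z - 1) + / 4) with z by field. unfold z. now rewrite finvK. }
    (* The point 3/8 corresponds to 1/2 under [4 x - 1]. *)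
    assert (E := Hau (3 / 8)). rewrite Ha in E. unfold u in E.
    rewrite fcompE, !fquarter_comp in E.
    replace (4 * (3 / 8) - 1) with (/ 2) in E by field. lra.
  - intros j x Hx Hax.
    destruct (gap_exists (copy_word j) x a (copy_word_emb j) Hx Hax) as (c & d & Hcd & G).
    exists c, d. split; [|exact Hcd]. apply NNPP. intros Hn. apply Hax.
    assert (Hi := copy_word_emb j).
    assert (HI : forall y, c < y < d -> inI y) by (intros y Hy; apply (gap_inI _ _ _ _ G); lra).
    (* With [y = u^-1 x], commutation on the gap turns [a x], which is the image of [y] under the
       other product, into [u y = x]. *)
    set (y := Phi (copy_word j (finv u)) x).
    assert (Hy : c < y < d).
    { pose proof (gap_lt _ _ _ G).
      apply gap_interval_invariant; try apply G; auto; apply (gap_inI _ _ _ _ G); lra. }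
    assert (Hcomm := unfaithful_gap_commute _ c d Hi G Hn b1 b2 y Hy).
    rewrite <- !act_fcomp in Hcomm by auto. fold u in Hcomm.
    unfold a. rewrite act_fcomp by auto. fold y. rewrite Hcomm.
    unfold y. now apply act_invK.
Qed.

(** Finiteness of the set of faithful gaps takes the form of a finite list meeting each of them: a
    grid of half the minimal gap length. *)
Lemma faithful_gap_samples iota : inj_hom_F iota -> exists P : list R,
  forall c d, faithful_gap iota c d -> exists p, In p P /\ c < p < d.
Proof.
  intros Hi. destruct (faithful_gap_length iota Hi) as [delta [Hd Hlen]].
  destruct (INR_unbounded (2 / delta)) as [N HN].
  exists (map (fun k => INR k * (delta / 2)) (seq 0 (S N))). intros c d Hf.
  specialize (Hlen c d Hf). destruct Hf as [G _].
  pose proof (gap_lo _ _ _ G). pose proof (gap_hi _ _ _ G).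
  assert (HNd : 1 < INR N * (delta / 2)).
  { apply Rmult_lt_reg_r with (2 / delta); [apply Rdiv_lt_0_compat; lra|].
    replace (INR N * (delta / 2) * (2 / delta)) with (INR N) by (field; lra). lra. }
  assert (Hex : forall k, c < INR k * (delta / 2) ->
            exists m, (m <= k)%nat /\ c < INR m * (delta / 2) < d).
  { induction k as [|k IH]; intros Hk; [simpl in Hk; lra|].
    destruct (Rlt_le_dec c (INR k * (delta / 2))) as [L|L].
    - destruct (IH L) as [m [Hm Hm']]. exists m. split; [lia|exact Hm'].
    - exists (S k). split; [lia|]. rewrite S_INR in *. lra. }
  destruct (Hex N) as [m [Hm Hm']]; [pose proof (gap_lt _ _ _ G); lra|].
  exists (INR m * (delta / 2)). split; [|exact Hm'].
  apply in_map_iff. exists m. split; [reflexivity|]. apply in_seq. lia.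
Qed.

(** The copies are conjugate under powers of [shift_el], so sample points for copy 0 are transported
    to copy [j]. One list thus bounds the number of gaps for all [j]. *)
Lemma copy_supp_samples : exists P : list R, forall j c d,
  faithful_gap (copy_word j) c d ->
  exists p, In p P /\ inI p /\ c < Phi [inl (fpow shift_el j)] p < d.
Proof.
  destruct (faithful_gap_samples (copy_word 0) (copy_word_emb 0)) as [P HP].
  exists P. intros j c d Hf.
  set (k := fpow shift_el j).
  assert (Hk : forall x, inI x -> Phi [inl k] (Phi [inl (finv k)] x) = x).
  { intros x Hx. rewrite <- (Phi_F k (finv k) (fcomp k (finv k)) x (fcompE _ _) Hx).
    rewrite <- (Phi_nil x Hx) at 2. apply Phi_wequiv; [|exact Hx].
    apply wequiv_step. constructor. intros y. now rewrite fcompE, finvK. }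
  assert (Ht := faithful_gap_transport (copy_word j) (copy_word 0) [inl (finv k)] c d).
  assert (Hf0 : faithful_gap (copy_word 0) (Phi [inl (finv k)] c) (Phi [inl (finv k)] d)).
  { apply Ht; [|exact Hf]. intros g x Hx. apply Phi_F_relation; [|exact Hx].
    intros y. unfold Fcopy. simpl. fold k. rewrite !fcompE, finvKl, fidE. f_equal.
    rewrite <- (fidE (Fval (finv fid) _)). now rewrite finvK. }
  destruct (HP _ _ Hf0) as [p [Hp Hcd]]. destruct Hf as [G _]. destruct Hf0 as [G0 _].
  assert (HIp : inI p) by (apply (gap_inI _ _ _ _ G0); lra).
  pose proof (gap_lt _ _ _ G).
  assert (HIc : inI c) by (apply (gap_inI _ _ _ _ G); lra).
  assert (HId : inI d) by (apply (gap_inI _ _ _ _ G); lra).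
  exists p. split; [exact Hp|split; [exact HIp|]].
  rewrite <- (Hk c HIc) at 1. rewrite <- (Hk d HId).
  split; apply Phi_lt; auto using Phi_I; lra.
Qed.

(** * Displacing the supports *)

Lemma eventually_all (A : Type) (P : list A) (Q : A -> nat -> Prop) :
  (forall p, In p P -> exists N, forall j, (N <= j)%nat -> Q p j) ->
  exists N, forall j, (N <= j)%nat -> forall p, In p P -> Q p j.
Proof.
  induction P as [|p P IH]; intros H; [exists 0%nat; intros j _ q []|].
  destruct (H p (or_introl eq_refl)) as [N1 H1].
  destruct IH as [N2 H2]; [intros; apply H; now right|].
  exists (max N1 N2). intros j Hj q [<-|Hq]; [apply H1; lia|apply H2; [lia|exact Hq]].
Qed.

Lemma eventually_not_copy_supp e : exists N, forall j, (N <= j)%nat -> ~ copy_supp j e.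
Proof.
  destruct (classic (exists i, copy_supp i e)) as [[i Hi]|H].
  - exists (S i). intros j Hj Hs. assert (i = j) by (eapply copy_supp_disjoint; eauto). lia.
  - exists 0%nat. intros j _ Hj. apply H. now exists j.
Qed.

(* There are finitely many endpoints, and each lies in at most one [copy_supp j]. *)
Lemma eventually_avoids_endpoints w l : exists N, forall j, (N <= j)%nat ->
  forall c d, faithful_gap (copy_word l) c d ->
    ~ copy_supp j (Phi w c) /\ ~ copy_supp j (Phi w d).
Proof.
  destruct (faithful_gap_samples (copy_word l) (copy_word_emb l)) as [P HP].
  destruct (eventually_all R P (fun p j => forall c d, faithful_gap (copy_word l) c d ->
    c < p < d -> ~ copy_supp j (Phi w c) /\ ~ copy_supp j (Phi w d))) as [N HN].
  - intros p _. destruct (classic (copy_supp l p)) as [(c & d & Hf & Hp)|Hn].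
    + destruct (eventually_not_copy_supp (Phi w c)) as [N1 H1].
      destruct (eventually_not_copy_supp (Phi w d)) as [N2 H2].
      exists (max N1 N2). intros j Hj c' d' Hf' Hp'.
      destruct (gap_unique _ _ _ _ _ p (proj1 Hf) (proj1 Hf') Hp Hp') as [<- <-].
      split; [apply H1|apply H2]; lia.
    + exists 0%nat. intros j _ c d Hf Hp. exfalso. apply Hn. now exists c, d.
  - exists N. intros j Hj c d Hf. destruct (HP c d Hf) as [p [Hp Hcd]].
    apply (HN j Hj p Hp c d Hf Hcd).
Qed.

Lemma pigeonhole (A : Type) (P : list A) (Q : nat -> A -> Prop) :
  (forall l, (l <= length P)%nat -> exists p, In p P /\ Q l p) ->
  exists i j p, i <> j /\ Q i p /\ Q j p.
Proof.
  intros H.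
  (* The bound on [l] moves under the quantifier since choice needs a total relation. *)
  assert (H' : forall l, exists p, (l <= length P)%nat -> In p P /\ Q l p).
  { intros l. destruct (le_dec l (length P)) as [Hl|Hl].
    - destruct (H l Hl) as [p Hp]. now exists p.
    - destruct (H 0%nat) as [p _]; [lia|]. exists p. lia. }
  destruct (functional_choice _ H') as [f Hf].
  apply NNPP. intros Hno.
  assert (Hnd : NoDup (map f (seq 0 (S (length P))))).
  { apply NoDup_map_NoDup_ForallPairs; [|apply seq_NoDup].
    intros i j Hi Hj E. apply in_seq in Hi, Hj. apply NNPP. intros Hij.
    apply Hno. exists i, j, (f i). repeat split; [exact Hij|apply Hf; lia|].
    rewrite E. apply Hf. lia. }
  assert (Hle := NoDup_incl_length Hnd (l' := P)).
  rewrite length_map, length_seq in Hle.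
  assert (S (length P) <= length P)%nat; [|lia]. apply Hle.
  intros p Hp. apply in_map_iff in Hp as [l [<- Hl]]. apply in_seq in Hl. apply Hf. lia.
Qed.

(** The length of the sample list replaces the number [n] of the overview: each [l] receives a
    sample point whose gap of copy [j] lies in [w U_l], and two indices sharing a point contradict
    disjointness. *)
Lemma copy_supp_displaced w : exists l j, forall x, copy_supp l x -> ~ copy_supp j (Phi w x).
Proof.
  apply NNPP. intros Hno.
  assert (Hmeet : forall l j, exists x, copy_supp l x /\ copy_supp j (Phi w x)).
  { intros l j. apply NNPP. intros H. apply Hno. exists l, j. intros x H1 H2.
    apply H. now exists x. }
  (* The list [P] is fixed before [j], which has to be large depending on its length. *)
  destruct copy_supp_samples as [P HP].
  destruct (eventually_all nat (seq 0 (S (length P))) (fun l j => forall c d,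
    faithful_gap (copy_word l) c d -> ~ copy_supp j (Phi w c) /\ ~ copy_supp j (Phi w d)))
    as [j Hj].
  { intros l _. apply eventually_avoids_endpoints. }
  specialize (Hj j (le_n j)).
  destruct (pigeonhole R P (fun l p => exists z, copy_supp l z /\
    Phi w z = Phi [inl (fpow shift_el j)] p)) as
    (l1 & l2 & p & Hl & (z1 & S1 & E1) & (z2 & S2 & E2)).
  - intros l Hl. destruct (Hmeet l j) as (x & (c & d & Hf & Hx) & (c' & d' & Hf' & Hx')).
    destruct (Hj l) with (c := c) (d := d) as [Nc Nd]; [apply in_seq; lia|exact Hf|].
    destruct (HP j c' d' Hf') as (p & Hp & HIp & Hpcd).
    exists p. split; [exact Hp|].
    assert (G := proj1 Hf).
    assert (HIc : inI c) by (apply (gap_inI _ _ _ _ G); lra).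
    assert (HId : inI d) by (apply (gap_inI _ _ _ _ G); lra).
    assert (HIx : inI x) by (apply (gap_inI _ _ _ _ G); lra).
    assert (Phi w c < Phi w x) by (apply Phi_lt; auto; lra).
    assert (Phi w x < Phi w d) by (apply Phi_lt; auto; lra).
    (* The gap (c', d') meets (w c, w d) and contains neither of its endpoints, hence lies inside
       it. *)
    assert (Phi w c <= c').
    { apply Rnot_lt_le. intros H'. apply Nc. exists c', d'. split; [exact Hf'|lra]. }
    assert (d' <= Phi w d).
    { apply Rnot_lt_le. intros H'. apply Nd. exists c', d'. split; [exact Hf'|lra]. }
    destruct (Phi_surj w (Phi [inl (fpow shift_el j)] p)) as [z [HIz Ez]]; [now apply Phi_I|].
    exists z. split; [|exact Ez]. exists c, d. split; [exact Hf|].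
    split; apply (Phi_lt_inv w); auto; lra.
  - apply Hl. apply (copy_supp_disjoint l1 l2 z1); [exact S1|].
    rewrite (Phi_inj w z1 z2); eauto using copy_supp_I. congruence.
Qed.

Lemma Phi_not_injective : ~ injective_FZ Phi.
Proof.
  intros Hinj.
  destruct commutator_supp as (a & Hne & Ha).
  destruct (copy_supp_displaced [inr 1%Z]) as (l & j & Hdis).
  apply (free_product_noncommuting (Fcopy j a) (Fcopy l a)); auto.
  apply Hinj. intros x Hx.
  set (v := [inr 1%Z; inl (Fcopy l a); inr (-1)%Z] : word).
  change (Phi (copy_word j a ++ v) x = Phi (v ++ copy_word j a) x).
  rewrite !Phi_app by exact Hx.
  apply (commute_of_disjoint R (Phi (copy_word j a)) (Phi v) inI);
    auto using Phi_I; try (intros; eapply Phi_inj; eassumption).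
  clear x Hx. intros x Hx.
  (* A point [x] moved by the first element lies in [U_j], so [t^-1 x] is outside [U_l] and is fixed
     by the copy of [a] there. Hence [v] fixes [x]. *)
  destruct (classic (Phi (copy_word j a) x = x)) as [E|E]; [now left|right].
  apply Ha in E; [|exact Hx].
  assert (Hinv : Phi [inr 1%Z] (Phi [inr (-1)%Z] x) = x).
  { rewrite <- Phi_app by exact Hx. rewrite <- (Phi_nil x Hx) at 2.
    apply Phi_wequiv; [|exact Hx]. eapply rst_trans; apply wequiv_step; constructor. }
  set (z := Phi [inr (-1)%Z] x) in *.
  assert (Hz : inI z) by (now apply Phi_I).
  assert (Ev : Phi v x = Phi [inr 1%Z] (Phi (copy_word l a) z)).
  { change v with ([inr 1%Z] ++ copy_word l a ++ [inr (-1)%Z]).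
    now rewrite !Phi_app by auto using Phi_I. }
  rewrite Ev. rewrite <- Hinv. f_equal. apply NNPP. intros Hmoved.
  apply (Hdis z); [now apply Ha|]. now rewrite Hinv.
Qed.

End Action.

Theorem theorem1p4 (Phi : word -> R -> R) :
  hom_FZ Phi ->
  (forall iota : Fel -> word, inj_hom_F iota ->
     forall J : R -> Prop, component (supp_action Phi iota) J ->
       nonfaithful_on Phi iota J \/ semiconj_standard Phi iota J) ->
  ~ injective_FZ Phi.
Proof. apply Phi_not_injective. Qed.
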